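(* Let $M$ be a smooth $(2n+1)$-dimensional manifold with a cosymplectic structure $(\eta,\theta)$, i.e. a closed 1-form $\eta$ and a closed 2-form $\theta$ with $\eta\wedge\theta^n\neq0$ at every point. If $\mathcal J$ represents the generalized almost contact structure associated to $(\eta,\theta)$, then it is a strong generalized contact structure. Moreover, the pairs of bundles $(L,L^* )$ and $(E^{(1,0)},E^{(0,1)})$ with respect to the induced Courant bracket are both Lie bialgebroids.
   Context: Setting: on sections of $TM\oplus T^*M$ put $\langle X+\alpha,Y+\beta\rangle=\frac12(\iota_X\beta+\iota_Y\alpha)$ and the Courant bracket $[\![X+\alpha,Y+\beta]\!]=[X,Y]+\mathcal L_X\beta-\mathcal L_Y\alpha-\frac12 d(\iota_X\beta-\iota_Y\alpha)$. Both are extended complex-linearly to $(TM\oplus T^*M)_{\mathbb C}$, and the anchor $\rho$ is the projection onto $TM_{\mathbb C}$. For a 2-form $\theta$, $\theta^\flat X=\theta(X,\cdot)$; for a bivector field $\pi$, $(\pi^\sharp\alpha)(\beta)=\pi(\alpha,\beta)$. Associated generalized almost contact structure $\mathcal J=(F,\eta,\pi,\theta,\varphi)$: $\flat(X)=\iota_X\theta-\eta(X)\eta$ is an isomorphism $TM\to T^*M$; $F$ is the unique vector field with $\eta(F)=1$ and $\iota_F\theta=0$; $\pi(\alpha,\beta)=\theta(\flat^{-1}(\alpha),\flat^{-1}(\beta))$; $\varphi=0$; $\Phi=\begin{pmatrix}0&\pi^\sharp\\ \theta^\flat&0\end{pmatrix}$, an endomorphism of $TM\oplus T^*M$. Bundles: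 $\ker\eta\subset TM$ and $\ker F=\{\alpha\in T^*M:\alpha(F)=0\}$; $L_F$ and $L_\eta$ are the complex line bundles spanned by $F$ and $\eta$; $E^{(1,0)}=\{e-i\Phi(e): e\in\ker\eta\oplus\ker F\}$, $E^{(0,1)}=\{e+i\Phi(e): e\in\ker\eta\oplus\ker F\}$; $L=L_F\oplus E^{(1,0)}$, $L^*=L_\eta\oplus E^{(0,1)}$. Through $\langle\cdot,\cdot\rangle$, $L^*$ is identified with the dual of $L$ and $E^{(0,1)}$ with the dual of $E^{(1,0)}$. The structure is a strong generalized contact structure if both $\Gamma(L)$ and $\Gamma(L^* )$ are closed under the Courant bracket. Lie bialgebroid: a pair $(A,A^* )$ of Lie algebroids in duality, such that the Lie algebroid differential $d_{A^*}$ (acting on $\Gamma(\wedge^\bullet A)$) satisfies $d_{A^*}[a_1,a_2]=[d_{A^*}a_1,a_2]+[a_1,d_{A^*}a_2]$ for all $a_1,a_2\in\Gamma(A)$. For the subbundles here, bracket and anchor are the restrictions of the Courant bracket and of $\rho$ (in particular the spaces of sections must be closed under the Courant bracket). *)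

(* Defs.v *)
From HB Require Import structures.
From mathcomp Require Import all_boot all_order all_algebra all_fingroup.
From mathcomp Require Import complex.
From mathcomp Require Import all_classical all_reals all_analysis.
Set Implicit Arguments.
Unset Strict Implicit.
Unset Printing Implicit Defensive.
Import Order.TTheory GRing.Theory Num.Theory numFieldNormedType.Exports.
Local Open Scope classical_set_scope.
Local Open Scope ring_scope.

Section Smoothness.
Variables (R : realType) (m : nat).
Implicit Type U : set 'rV[R]_m.

Definition partial (i : 'I_m) (f : 'rV[R]_m -> R) : 'rV[R]_m -> R :=
  fun x => 'D_'e_i f x.

(* C^oo: differentiability of all iterated partial derivatives gives both their
   existence and their continuity at every order. *)
Definition smooth_on U (f : 'rV[R]_m -> R) : Prop :=
  forall s : seq 'I_m, forall x, U x -> differentiable (foldr partial f s) x.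

Definition smooth_mx_on p q U (f : 'rV[R]_m -> 'M[R]_(p, q)) : Prop :=
  forall i j, smooth_on U (fun x => f x i j).

Definition cpartial (i : 'I_m) (f : 'rV[R]_m -> R[i]) : 'rV[R]_m -> R[i] :=
  fun x => (partial i (fun y => complex.Re (f y)) x
            +i* partial i (fun y => complex.Im (f y)) x)%C.

Definition csmooth_on U (f : 'rV[R]_m -> R[i]) : Prop :=
  smooth_on U (fun x => complex.Re (f x)) /\
  smooth_on U (fun x => complex.Im (f x)).

Definition csmooth_mx_on p q U (f : 'rV[R]_m -> 'M[R[i]]_(p, q)) : Prop :=
  forall i j, csmooth_on U (fun x => f x i j).

End Smoothness.

Record manifold (R : realType) (m : nat) := Manifold {
  mpoint : topologicalType;
  chart : Type;
  chart_dom : chart -> set mpoint;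
  chart_cod : chart -> set 'rV[R]_m;
  chart_map : chart -> mpoint -> 'rV[R]_m;
  chart_inv : chart -> 'rV[R]_m -> mpoint;
  mpoint_hausdorff : hausdorff_space mpoint;
  mpoint_second_countable : @second_countable mpoint;
  open_chart_dom : forall c, open (chart_dom c);
  open_chart_cod : forall c, open (chart_cod c);
  chart_map_cod : forall c p, chart_dom c p -> chart_cod c (chart_map c p);
  chart_inv_dom : forall c x, chart_cod c x -> chart_dom c (chart_inv c x);
  chart_mapK : forall c p, chart_dom c p -> chart_inv c (chart_map c p) = p;
  chart_invK : forall c x, chart_cod c x -> chart_map c (chart_inv c x) = x;
  chart_map_continuous : forall c, {within chart_dom c, continuous (chart_map c)};
  chart_inv_continuous : forall c, {within chart_cod c, continuous (chart_inv c)};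
  chart_cover : forall p, exists c, chart_dom c p;
  chart_smooth : forall c d,
    smooth_mx_on [set x | chart_cod c x /\ chart_dom d (chart_inv c x)]
      (fun x => chart_map d (chart_inv c x))
}.

(* An element of the fibre of TM (+) T*M, as a pair of rows: the components of
   the tangent vector on the coordinate fields and of the covector on their
   dual basis. *)
Notation gfib K m := ('rV[K]_m * 'rV[K]_m)%type.

Section LocalCalculus.
Variables (R : realType) (m : nat).

Definition contract (K : comNzRingType) (a X : 'rV[K]_m) : K :=
  \sum_i a 0 i * X 0 i.

Definition pairing (u v : gfib R[i] m) : R[i] :=
  2^-1 * (contract v.2 u.1 + contract u.2 v.1).

Implicit Types (X Y a b : 'rV[R]_m -> 'rV[R[i]]_m) (f : 'rV[R]_m -> R[i]).
Implicit Types (e : 'rV[R]_m -> gfib R[i] m).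

Definition vderiv X f : 'rV[R]_m -> R[i] :=
  fun x => \sum_j X x 0 j * cpartial j f x.

Definition dfun f : 'rV[R]_m -> 'rV[R[i]]_m := fun x => \row_i cpartial i f x.

Definition vbracket X Y : 'rV[R]_m -> 'rV[R[i]]_m := fun x =>
  \row_i (vderiv X (fun y => Y y 0 i) x - vderiv Y (fun y => X y 0 i) x).

Definition lie1 X b : 'rV[R]_m -> 'rV[R[i]]_m := fun x =>
  \row_i (vderiv X (fun y => b y 0 i) x
          + \sum_j b x 0 j * cpartial i (fun y => X y 0 j) x).

Definition courant_loc e1 e2 : 'rV[R]_m -> gfib R[i] m := fun x =>
  (vbracket (fun y => (e1 y).1) (fun y => (e2 y).1) x,
   lie1 (fun y => (e1 y).1) (fun y => (e2 y).2) x
   - lie1 (fun y => (e2 y).1) (fun y => (e1 y).2) x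
   - 2^-1 *: dfun (fun y => contract (e2 y).2 (e1 y).1
                            - contract (e1 y).2 (e2 y).1) x).

Definition real_mx p q (A : 'M[R]_(p, q)) : 'M[R[i]]_(p, q) :=
  map_mx (real_complex R) A.

Definition complexify (e : gfib R m) : gfib R[i] m :=
  (real_mx e.1, real_mx e.2).

End LocalCalculus.

(* Fields on M are families of local components, one function per chart,
   subject to the usual tensorial transformation rules. Only the values of the
   [c]-th function on [chart_cod c] matter. *)
Section Fields.
Variables (R : realType) (m : nat) (M : manifold R m).

Definition mfield (V : Type) := chart M -> 'rV[R]_m -> V.

Definition overlap (c d : chart M) : set 'rV[R]_m :=
  [set x | chart_cod c x /\ chart_dom d (chart_inv c x)].

Definition transition (c d : chart M) : 'rV[R]_m -> 'rV[R]_m :=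
  fun x => chart_map d (chart_inv c x).

(* [v *m jac c d x] is the differential of the transition map applied to [v]. *)
Definition jac (c d : chart M) (x : 'rV[R]_m) : 'M[R]_m :=
  jacobian (transition c d) x.

Definition is_vector_field (X : mfield 'rV[R]_m) : Prop :=
  (forall c, smooth_mx_on (chart_cod c) (X c)) /\
  (forall c d x, overlap c d x -> X d (transition c d x) = X c x *m jac c d x).

Definition is_one_form (a : mfield 'rV[R]_m) : Prop :=
  (forall c, smooth_mx_on (chart_cod c) (a c)) /\
  (forall c d x, overlap c d x ->
     a c x = a d (transition c d x) *m (jac c d x)^T).

(* theta(X, Y) = X *m theta *m Y^T *)
Definition is_two_form (theta : mfield 'M[R]_m) : Prop :=
  [/\ forall c, smooth_mx_on (chart_cod c) (theta c),
      forall c x, chart_cod c x -> (theta c x)^T = - theta c x &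
      forall c d x, overlap c d x ->
        theta c x = jac c d x *m theta d (transition c d x) *m (jac c d x)^T].

(* pi(alpha, beta) = alpha *m pi *m beta^T *)
Definition is_bivector_field (pi : mfield 'M[R]_m) : Prop :=
  [/\ forall c, smooth_mx_on (chart_cod c) (pi c),
      forall c x, chart_cod c x -> (pi c x)^T = - pi c x &
      forall c d x, overlap c d x ->
        pi d (transition c d x) = (jac c d x)^T *m pi c x *m jac c d x].

Definition is_cfunction (f : mfield R[i]) : Prop :=
  (forall c, csmooth_on (chart_cod c) (f c)) /\
  (forall c d x, overlap c d x -> f d (transition c d x) = f c x).

Definition gtransforms (c d : chart M) (x : 'rV[R]_m)
    (u v : gfib R[i] m) : Prop :=
  v.1 = u.1 *m real_mx (jac c d x) /\ u.2 = v.2 *m (real_mx (jac c d x))^T.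

(* smooth sections of the complexification of TM (+) T*M *)
Definition is_gsection (e : mfield (gfib R[i] m)) : Prop :=
  [/\ forall c, csmooth_mx_on (chart_cod c) (fun x => (e c x).1),
      forall c, csmooth_mx_on (chart_cod c) (fun x => (e c x).2) &
      forall c d x, overlap c d x ->
        gtransforms c d x (e c x) (e d (transition c d x))].

Definition closed1 (a : mfield 'rV[R]_m) : Prop :=
  forall c x, chart_cod c x -> forall i j,
    partial i (fun y => a c y 0 j) x - partial j (fun y => a c y 0 i) x = 0.

Definition closed2 (theta : mfield 'M[R]_m) : Prop :=
  forall c x, chart_cod c x -> forall i j k,
    partial i (fun y => theta c y j k) x
    + partial j (fun y => theta c y k i) x
    + partial k (fun y => theta c y i j) x = 0.

End Fields.

(* The component of eta /\ theta^n on the coordinate frame, up to the nonzero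
   factor 2^n coming from the normalization of the wedge product. *)
Definition top_wedge (R : realType) (n : nat)
    (eta : 'rV[R]_(n.*2.+1)) (theta : 'M[R]_(n.*2.+1)) : R :=
  \sum_(s : 'S_(n.*2.+1)) (-1) ^+ s * eta 0 (s ord0) *
    \prod_(k < n) theta (s (inord k.*2.+1)) (s (inord k.*2.+2)).

Definition cosymplectic (R : realType) (n : nat) (M : manifold R n.*2.+1)
    (eta : mfield M 'rV[R]_(n.*2.+1)) (theta : mfield M 'M[R]_(n.*2.+1)) : Prop :=
  [/\ is_one_form eta /\ closed1 eta, is_two_form theta /\ closed2 theta &
      forall c x, chart_cod c x -> top_wedge (eta c x) (theta c x) != 0].

Section GeneralizedAlmostContact.
Variables (R : realType) (m : nat) (M : manifold R m).

Record gac_structure := GacStructure {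
  gF : mfield M 'rV[R]_m;
  geta : mfield M 'rV[R]_m;
  gpi : mfield M 'M[R]_m;
  gtheta : mfield M 'M[R]_m;
  gphi : mfield M 'M[R]_m
}.

(* The matrix of X |-> i_X theta - eta(X) eta acting on rows. *)
Definition flat_mx (eta : 'rV[R]_m) (theta : 'M[R]_m) : 'M[R]_m :=
  theta - eta^T *m eta.

Definition associated (eta : mfield M 'rV[R]_m) (theta : mfield M 'M[R]_m)
    (J : gac_structure) : Prop :=
  [/\ is_vector_field (gF J), is_bivector_field (gpi J) &
   forall c x, chart_cod c x ->
    [/\ geta J c x = eta c x, gtheta J c x = theta c x, gphi J c x = 0,
        contract (eta c x) (gF J c x) = 1 /\ gF J c x *m theta c x = 0 &
        forall a b : 'rV[R]_m,
          a *m gpi J c x *m b^T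
          = (a *m invmx (flat_mx (eta c x) (theta c x))) *m theta c x
              *m (b *m invmx (flat_mx (eta c x) (theta c x)))^T]].

Variable J : gac_structure.
Implicit Types (c : chart M) (x : 'rV[R]_m).

(* The endomorphism with blocks (phi, pi^sharp; theta^flat, - phi^* ). *)
Definition gPhi c x (e : gfib R m) : gfib R m :=
  (e.1 *m gphi J c x + e.2 *m gpi J c x,
   e.1 *m gtheta J c x - e.2 *m (gphi J c x)^T).

Definition ker_sum c x : set (gfib R m) :=
  [set e | contract (geta J c x) e.1 = 0 /\ contract e.2 (gF J c x) = 0].

Definition gbundle := mfield M (set (gfib R[i] m)).

Definition E10 : gbundle := fun c x =>
  [set u | exists2 e, ker_sum c x e &
     u = complexify e - 'i%C *: complexify (gPhi c x e)].

Definition E01 : gbundle := fun c x =>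
  [set u | exists2 e, ker_sum c x e &
     u = complexify e + 'i%C *: complexify (gPhi c x e)].

Definition L_F : gbundle := fun c x =>
  [set u | exists z : R[i], u = z *: complexify (gF J c x, 0)].

Definition L_eta : gbundle := fun c x =>
  [set u | exists z : R[i], u = z *: complexify (0, geta J c x)].

Definition bundle_sum (A B : gbundle) : gbundle := fun c x =>
  [set u + v | u in A c x & v in B c x].

Definition bundle_L : gbundle := bundle_sum L_F E10.
Definition bundle_Lstar : gbundle := bundle_sum L_eta E01.

End GeneralizedAlmostContact.

Section LieBialgebroids.
Variables (R : realType) (m : nat) (M : manifold R m).
Implicit Types (A B : gbundle M) (a b e : mfield M (gfib R[i] m)).

Definition courant a b : mfield M (gfib R[i] m) :=
  fun c => courant_loc (a c) (b c).

Definition gsections A : set (mfield M (gfib R[i] m)) :=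
  [set e | is_gsection e /\ forall c x, chart_cod c x -> A c x (e c x)].

Definition courant_closed A : Prop :=
  forall a b, gsections A a -> gsections A b -> gsections A (courant a b).

Definition strong (J : gac_structure M) : Prop :=
  courant_closed (bundle_L J) /\ courant_closed (bundle_Lstar J).

(* Sections over an open subset [U] of [chart_cod c]. *)
Definition local_section A (c : chart M) (U : set 'rV[R]_m)
    (s : 'rV[R]_m -> gfib R[i] m) : Prop :=
  [/\ csmooth_mx_on U (fun x => (s x).1), csmooth_mx_on U (fun x => (s x).2) &
      forall x, U x -> A c x (s x)].

(* Compatible with changes of charts, and with a smooth local frame of constant
   length [r] around every point. *)
Definition is_subbundle A : Prop :=
  (forall c d x u v, overlap c d x -> gtransforms c d x u v ->
     A c x u <-> A d (transition c d x) v) /\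
  exists r : nat, forall c x, chart_cod c x ->
    exists (U : set 'rV[R]_m) (s : 'I_r -> 'rV[R]_m -> gfib R[i] m),
      [/\ open U, U x, U `<=` chart_cod c, forall k, local_section A c U (s k) &
          forall y u, U y ->
            A c y u <-> exists! k : 'rV[R[i]]_r, u = \sum_i k 0 i *: s i y].

(* Complex Lie algebroid for the Courant bracket and the projection to TM;
   homogeneity of the bracket over C is the case of constant [f] in the
   Leibniz rule. *)
Record lie_algebroid A : Prop := LieAlgebroid {
  la_subbundle : is_subbundle A;
  la_closed : courant_closed A;
  la_additive : forall a b e, gsections A a -> gsections A b -> gsections A e ->
    forall c x, chart_cod c x ->
      courant e (fun d y => a d y + b d y) c x
      = courant e a c x + courant e b c x;
  la_antisym : forall a b, gsections A a -> gsections A b ->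
    forall c x, chart_cod c x -> courant a b c x = - courant b a c x;
  la_jacobi : forall a b e, gsections A a -> gsections A b -> gsections A e ->
    forall c x, chart_cod c x ->
      courant a (courant b e) c x + courant b (courant e a) c x
      + courant e (courant a b) c x = 0;
  la_leibniz : forall a b f, gsections A a -> gsections A b -> is_cfunction f ->
    forall c x, chart_cod c x ->
      courant a (fun d y => f d y *: b d y) c x
      = f c x *: courant a b c x
        + vderiv (fun y => (a c y).1) (f c) x *: b c x
}.

(* The pairing identifies each fibre of [B] with the dual of that of [A]. *)
Definition in_duality A B : Prop := forall c x, chart_cod c x ->
  (forall u, A c x u -> (forall v, B c x v -> pairing u v = 0) -> u = 0) /\
  (forall v, B c x v -> (forall u, A c x u -> pairing u v = 0) -> v = 0).

Implicit Types (s t xi zeta : 'rV[R]_m -> gfib R[i] m).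

(* Sections of wedge^2 A are regarded as alternating forms on A^*. *)
Definition wedge s t xi zeta : 'rV[R]_m -> R[i] := fun x =>
  pairing (s x) (xi x) * pairing (t x) (zeta x)
  - pairing (s x) (zeta x) * pairing (t x) (xi x).

(* The differential of A^* on a section of A = (A^* )^*. *)
Definition d_star s xi zeta : 'rV[R]_m -> R[i] := fun x =>
  vderiv (fun y => (xi y).1) (fun y => pairing (s y) (zeta y)) x
  - vderiv (fun y => (zeta y).1) (fun y => pairing (s y) (xi y)) x
  - pairing (s x) (courant_loc xi zeta x).

(* d_star s = sum_k (P k).1 /\ (P k).2 as sections of wedge^2 A over U, with
   B = A^*. *)
Definition d_star_decomp A B (c : chart M) (U : set 'rV[R]_m) s (r : nat)
    (P : 'I_r -> ('rV[R]_m -> gfib R[i] m) * ('rV[R]_m -> gfib R[i] m)) : Prop :=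
  (forall k, local_section A c U (P k).1 /\ local_section A c U (P k).2) /\
  forall (V : set 'rV[R]_m) xi zeta, open V -> V `<=` U ->
    local_section B c V xi -> local_section B c V zeta ->
    forall x, V x ->
      d_star s xi zeta x = \sum_k wedge (P k).1 (P k).2 xi zeta x.

(* Schouten brackets [sum_k b_k /\ c_k, s] and [s, sum_k b_k /\ c_k]: the
   extension of the bracket of A by derivations. *)
Definition schouten_r (r : nat)
    (P : 'I_r -> ('rV[R]_m -> gfib R[i] m) * ('rV[R]_m -> gfib R[i] m))
    s xi zeta : 'rV[R]_m -> R[i] := fun x =>
  \sum_k (wedge (courant_loc (P k).1 s) (P k).2 xi zeta x
          + wedge (P k).1 (courant_loc (P k).2 s) xi zeta x).

Definition schouten_l s (r : nat)
    (P : 'I_r -> ('rV[R]_m -> gfib R[i] m) * ('rV[R]_m -> gfib R[i] m))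
    xi zeta : 'rV[R]_m -> R[i] := fun x =>
  \sum_k (wedge (courant_loc s (P k).1) (P k).2 xi zeta x
          + wedge (P k).1 (courant_loc s (P k).2) xi zeta x).

(* d_star [a1, a2] = [d_star a1, a2] + [a1, d_star a2]. Decompositions of
   d_star a1 and d_star a2 always exist around each point (take a frame of A
   and the dual frame of A^* ), and the Schouten brackets do not depend on
   them, so the condition is local and quantified over all of them. *)
Definition bialgebroid_compatible A B : Prop :=
  forall a1 a2, gsections A a1 -> gsections A a2 ->
  forall (c : chart M) (U : set 'rV[R]_m), open U -> U `<=` chart_cod c ->
  forall (r1 r2 : nat)
    (P1 : 'I_r1 -> ('rV[R]_m -> gfib R[i] m) * ('rV[R]_m -> gfib R[i] m))
    (P2 : 'I_r2 -> ('rV[R]_m -> gfib R[i] m) * ('rV[R]_m -> gfib R[i] m)),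
  d_star_decomp A B c U (a1 c) P1 -> d_star_decomp A B c U (a2 c) P2 ->
  forall xi zeta, local_section B c U xi -> local_section B c U zeta ->
  forall x, U x ->
    d_star (courant a1 a2 c) xi zeta x
    = schouten_r P1 (a2 c) xi zeta x + schouten_l (a1 c) P2 xi zeta x.

Definition lie_bialgebroid A B : Prop :=
  [/\ lie_algebroid A, lie_algebroid B, in_duality A B &
      bialgebroid_compatible A B].

End LieBialgebroids.

(* Main.v *)
Require Import Defs.
From HB Require Import structures.
From mathcomp Require Import all_boot all_order all_algebra all_fingroup.
From mathcomp Require Import complex ring lra zify.
From mathcomp Require Import all_classical all_reals all_analysis.
Import Defs.
Set Implicit Arguments.
Unset Strict Implicit.
Unset Printing Implicit Defensive.
Import Order.TTheory GRing.Theory Num.Theory numFieldNormedType.Exports.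
Local Open Scope classical_set_scope.
Local Open Scope ring_scope.

(* In every chart the four bundles are graphs.  Since [theta] is invertible modulo [eta], [L] is the
   graph of [- i theta] over the whole complexified tangent bundle, [L^*] is the graph of [i theta]
   over [ker eta] plus the line spanned by [eta], and [E^(1,0)], [E^(0,1)] are the graphs of
   [- i theta], [i theta] over [ker eta].  Because [eta] and [theta] are closed, the Courant bracket
   of two sections with vector parts [X], [Y] and [eta]-coefficients [z], [z'] is the section with
   vector part [[X, Y]] and [eta]-coefficient [X z' - Y z]; closedness, the Jacobi identity and the
   Leibniz rule follow.  For compatibility, the pairing identifies [L^*] with covectors so that
   the differential of [L^*] on a section of [L] with vector part [a] becomes the Lie derivative
   [- i L_a pi]; the compatibility condition is then [L_[a1, a2] = L_a1 L_a2 - L_a2 L_a1] on [pi].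

   The computations are identities between matrices over a commutative ring with [m] commuting
   derivations, applied to the ring of complex functions that are smooth on an open set. *)

(** * Smooth real functions *)

(** On all of [TM + T*M] the Courant bracket violates the Jacobi identity and the Leibniz rule in
    general, so these axioms need the special shape of the bundles: a graph over the whole tangent
    bundle must have zero [eta]-coefficient, and a nonzero coefficient forces the vector parts into
    [ker eta]. The condition [p || q] on normal forms records this.

    Compatibility is quantified over arbitrary decompositions of [d_star a] into wedges, known only
    through their values on local sections. Hence a decomposition must first be shown to determine
    the bivector [- i L_a pi] itself. For the pair [E^(1,0)], [E^(0,1)] only covectors killing [F]
    are available as tests, which is the delicate case.

    Fields are given chart by chart, so closure also requires the bracket to transform correctly.
    This is not checked on 1-forms: in a graph bundle the covector is determined by the vector part
    and the scalar [eta]-coefficient, so naturality of the Lie bracket and of directional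
    derivatives suffices. *)

Section Locality.
Variables (R : realType) (V W : normedModType R).
Implicit Types (f g : V -> W) (U : set V).

(** The zero map satisfies the defining expansion with a remainder that vanishes identically near
    [x]; uniqueness of the differential does the rest. *)
Lemma near0_differentiable f x : (\forall y \near x, f y = 0) ->
  differentiable f x.
Proof.
move=> f0; have fx0 : f x = 0 by exact: nbhs_singleton f0.
have e0 : f \o shift x = cst (f x) + \0 +o_ 0 id.
  apply/eqaddoP => e e0; near=> h.
  rewrite (_ : (_ - _) h = 0) ?normr0 ?mulr_ge0 ?normr_ge0 ?(ltW e0)//.
  rewrite -[LHS]/(f (h + x) - (f x + 0)) fx0 !addr0 subr0.
  near: h; move: f0; rewrite (near_shift 0 x) subr0; exact: filterS.
have c0 : continuous (\0 : V -> W) by exact: cst_continuous.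
by apply/diff_locallyP; rewrite (diff_unique c0 e0).
Unshelve. all: by end_near. Qed.

Lemma near_eq_differentiable f g x : (\forall y \near x, f y = g y) ->
  differentiable f x -> differentiable g x.
Proof.
move=> fg df; rewrite -[g](subrK f); apply: differentiableD df.
apply: near0_differentiable; apply: filterS fg => y fgy.
by rewrite -[LHS]/(g y - f y) fgy subrr.
Qed.

End Locality.

Section RealSmooth.
Variables (R : realType) (m : nat) (U : set 'rV[R]_m).
Hypothesis openU : open U.
Implicit Types (f g : 'rV[R]_m -> R) (x : 'rV[R]_m).

Lemma open_near (T : Type) (f g : 'rV[R]_m -> T) x :
  {in U, f =1 g} -> U x -> \forall y \near x, f y = g y.
Proof.
move=> fg Ux; have : nbhs x U by exact: open_nbhs_nbhs.
by apply: filterS => y Uy; apply: fg; rewrite inE.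
Qed.

Lemma eq_partial i f g x : {in U, f =1 g} -> U x -> partial i f x = partial i g x.
Proof. by move=> fg Ux; exact/near_eq_derive/open_near. Qed.

Lemma smooth_differentiable f x : smooth_on U f -> U x -> differentiable f x.
Proof. by move=> sf Ux; exact: (sf [::]). Qed.

Lemma smooth_partial i f : smooth_on U f -> smooth_on U (partial i f).
Proof. by move=> sf s x Ux; move: (sf (rcons s i) x Ux); rewrite foldr_rcons. Qed.

(** Smoothness is the largest property that implies differentiability and is stable under [partial].
    Arguing this way avoids any closed formula for the iterated derivatives of a product. *)
Lemma smooth_coind (P : ('rV[R]_m -> R) -> Prop) :
  (forall f x, P f -> U x -> differentiable f x) ->
  (forall f i, P f -> P (partial i f)) ->
  forall f, P f -> smooth_on U f.
Proof.
move=> Pd Pp f Pf s; suff: P (foldr (@partial R m) f s) by move=> Ps x; exact: Pd.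
by elim: s => //= i s; exact: Pp.
Qed.

(** The sum and product rules for [partial] hold only at points of [U], so stability under [partial]
    requires the constructor [SmoothExt]. *)
Inductive smooth_alg : ('rV[R]_m -> R) -> Prop :=
| SmoothBase f of smooth_on U f : smooth_alg f
| SmoothCst (a : R) : smooth_alg (fun=> a)
| SmoothAdd f g of smooth_alg f & smooth_alg g : smooth_alg (fun x => f x + g x)
| SmoothMul f g of smooth_alg f & smooth_alg g : smooth_alg (fun x => f x * g x)
| SmoothExt f g of {in U, f =1 g} & smooth_alg f : smooth_alg g.

Lemma smooth_alg_diff f : smooth_alg f -> forall x, U x -> differentiable f x.
Proof.
elim=> {f} [f sf|a|f g _ df _ dg|f g _ df _ dg|f g fg _ df] x Ux.
- exact: smooth_differentiable.
- exact: differentiable_cst.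
- by apply: (@differentiableD _ _ _ f g); [exact: df|exact: dg].
- by apply: (@differentiableM _ _ f g); [exact: df|exact: dg].
- by apply: near_eq_differentiable (df x Ux); exact: open_near.
Qed.

Lemma partialD i f g x : differentiable f x -> differentiable g x ->
  partial i (fun y => f y + g y) x = partial i f x + partial i g x.
Proof. by move=> df dg; rewrite -deriveD//; exact: diff_derivable. Qed.

Lemma partialM i f g x : differentiable f x -> differentiable g x ->
  partial i (fun y => f y * g y) x = partial i f x * g x + f x * partial i g x.
Proof.
move=> df dg; rewrite [LHS](@deriveM _ _ f g); try exact: diff_derivable.
by rewrite addrC mulrC.
Qed.

Lemma partial_cst i (a : R) x : partial i (fun=> a) x = 0.
Proof. exact: derive_cst. Qed.

Lemma smooth_alg_partial f i : smooth_alg f -> smooth_alg (partial i f).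
Proof.
elim=> {f} [f sf|a|f g af df ag dg|f g af df ag dg|f g fg af df].
- exact/SmoothBase/smooth_partial.
- apply: SmoothExt (SmoothCst 0) => x _; rewrite partial_cst//.
- apply: SmoothExt (SmoothAdd df dg) => x /set_mem Ux.
  by rewrite partialD//; exact: smooth_alg_diff.
- apply: SmoothExt (SmoothAdd (SmoothMul df ag) (SmoothMul af dg)) => x /set_mem Ux.
  by rewrite partialM//; exact: smooth_alg_diff.
- by apply: SmoothExt df => x /set_mem Ux; exact: eq_partial.
Qed.

Lemma smooth_algP f : smooth_alg f -> smooth_on U f.
Proof.
apply: smooth_coind => [g x ag|g i]; [exact: smooth_alg_diff|exact: smooth_alg_partial].
Qed.

End RealSmooth.

(** * Symmetry of second derivatives *)

Section Schwarz.
Variables (R : realType) (m : nat) (U : set 'rV[R]_m).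
Hypothesis openU : open U.
Implicit Types (f : 'rV[R]_m -> R) (x p v w : 'rV[R]_m).

Lemma is_derive_line f p v (s : R) : differentiable f (p + s *: v) ->
  is_derive s (1 : R) (fun t => f (p + t *: v)) ('D_v f (p + s *: v)).
Proof.
move=> df; have : derivable f (p + s *: v) v by exact: diff_derivable.
rewrite /derivable /derive => dv.
have e : (fun h : R => h^-1 *: (f (p + (h *: 1 + s) *: v) - f (p + s *: v)))
    = (fun h : R => h^-1 *: (f (h *: v + (p + s *: v)) - f (p + s *: v))).
  by apply/funext => h; rewrite (_ : h *: (1 : R) = h) ?scalerDl 1?addrCA//; exact: mulr1.
by split; rewrite /derivable /derive /= e.
Qed.

Lemma line_mvt f p v (h : R) : 0 < h ->
  (forall s : R, 0 <= s <= h -> differentiable f (p + s *: v)) ->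
  exists2 s : R, 0 < s < h & f (p + h *: v) - f p = 'D_v f (p + s *: v) * h.
Proof.
move=> h0 df.
have [||s] := @MVT R (fun t => f (p + t *: v)) (fun s => 'D_v f (p + s *: v)) 0 h h0.
- move=> s; rewrite in_itv/= => /andP[s0 sh]; apply: is_derive_line.
  by apply: df; rewrite !ltW.
- apply: derivable_within_continuous => s; rewrite in_itv/= => sh.
  by have [] := is_derive_line (df _ sh).
by rewrite in_itv/= scale0r addr0 subr0 => sh ->; exists s.
Qed.

Lemma differentiable_shift f y v : differentiable f (y + v) ->
  differentiable (fun z => f (z + v)) y.
Proof.
move=> df; apply: (@differentiable_comp _ _ _ _ (fun z => z + v) f) => //.
Qed.

Lemma derive_shifted f y v w : 'D_w (fun z => f (z + v)) y = 'D_w f (y + v).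
Proof.
by rewrite /derive; under eq_fun do rewrite /= -addrA.
Qed.

Lemma near_plane (P : 'rV[R]_m -> Prop) x v w : (\forall y \near x, P y) ->
  exists2 r : R, 0 < r &
    forall s t, `|s| < r -> `|t| < r -> P (x + s *: v + t *: w).
Proof.
(* The summand 1 keeps [k] positive when both directions vanish, and makes the final estimate
   strict. *)
move=> /nbhs_ballP[e /= e0 eP]; pose k := `|v| + `|w| + 1.
have k0 : 0 < k by rewrite ltr_wpDl// addr_ge0.
exists (e / k) => [|s t sr tr]; first exact: divr_gt0.
apply: eP; rewrite -ball_normE /= -addrA opprD addNKr normrN.
rewrite (le_lt_trans (ler_normD _ _))// !normrZ.
have ek : e / k * `|v| + e / k * `|w| + e / k = e.
  by rewrite -[RHS](divfK (lt0r_neq0 k0)); set c := e / k; rewrite /k; ring.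
rewrite -[ltRHS]ek ltr_pwDr ?divr_gt0//.
by rewrite lerD// ler_wpM2r// ltW.
Qed.

(** The mean value theorem is applied twice: along ['e_i] to the increment [g] of [f] in the
    direction ['e_j], then along ['e_j] to [partial i f]. *)
Lemma second_difference f i j x (r : R) (h : R) : smooth_on U f ->
  (forall s t, `|s| < r -> `|t| < r -> U (x + s *: 'e_i + t *: 'e_j)) ->
  0 < h < r ->
  exists s t, [/\ `|s| < h, `|t| < h &
    f (x + h *: 'e_i + h *: 'e_j) - f (x + h *: 'e_i)
      - (f (x + h *: 'e_j) - f x)
    = partial j (partial i f) (x + s *: 'e_i + t *: 'e_j) * h * h].
Proof.
move=> sf Ur /andP[h0 hr].
have abs s : 0 <= s <= h -> `|s| < r.
  by move=> /andP[s0 sh]; rewrite ger0_norm// (le_lt_trans sh).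
have r0 : `|0 : R| < r by rewrite normr0 (lt_trans h0).
pose g y := f (y + h *: 'e_j) - f y.
have dx1 s : 0 <= s <= h -> differentiable f (x + s *: 'e_i).
  move=> sh; apply: (smooth_differentiable sf).
  by rewrite -[_ + _]addr0 -(scale0r 'e_j); apply: Ur => //; exact: abs.
have dx2 s : 0 <= s <= h -> differentiable f (x + s *: 'e_i + h *: 'e_j).
  move=> sh; apply: (smooth_differentiable sf).
  by apply: Ur; apply: abs; rewrite // lexx ltW.
have dg s : 0 <= s <= h -> differentiable g (x + s *: 'e_i).
  move=> sh; apply: differentiableB; last exact: dx1.
  exact/differentiable_shift/dx2.
have [s /andP[s0 sh] es] := @line_mvt g x 'e_i h h0 dg.
have sh' : 0 <= s <= h by rewrite !ltW.
have [t' t'h|t /andP[t0 th] et] :=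
  @line_mvt (partial i f) (x + s *: 'e_i) 'e_j h h0.
  apply: (smooth_differentiable (smooth_partial i sf)).
  by apply: Ur; exact: abs.
exists s, t; split; rewrite ?gtr0_norm//.
rewrite -[LHS]/(g (x + h *: 'e_i) - g x) es; congr (_ * _).
rewrite -et deriveB; [|exact/diff_derivable/differentiable_shift/dx2|exact/diff_derivable/dx1].
by rewrite derive_shifted.
Qed.

(** Equal second differences force [A = B], and one number cannot lie within less than half of
    [|a - b|] of both [a] and [b]. *)
Let two_halves_lt (a b A B h D E : R) : h != 0 -> D = A * h * h -> E = B * h * h ->
  D = E -> `|b - A| < `|a - b| / 2 -> `|a - B| < `|a - b| / 2 -> False.
Proof.
move=> h0 -> -> /(mulIf h0)/(mulIf h0) <- bA aA.
have : `|a - b| < `|a - b| / 2 + `|a - b| / 2.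
  by rewrite -{1}(subrKA A a) (le_lt_trans (ler_normD _ _))// ltrD// distrC.
by rewrite -splitr ltxx.
Qed.

(* Both iterated derivatives, taken at points arbitrarily close to [x], equal the same second
   difference quotient. *)
Lemma partialC f i j x : smooth_on U f -> U x ->
  partial i (partial j f) x = partial j (partial i f) x.
Proof.
move=> sf Ux; apply/eqP/negP => /negP; rewrite -subr_eq0 -normr_gt0.
have near_val i1 i2 (e : R) : 0 < e -> \forall y \near x,
    `|partial i1 (partial i2 f) x - partial i1 (partial i2 f) y| < e.
  move=> e0; have ct : {for x, continuous (partial i1 (partial i2 f))}.
    apply: differentiable_continuous; apply: smooth_differentiable Ux.
    by do 2!apply: smooth_partial.
  by move/cvgrPdist_lt : ct => /(_ e e0).
move: (near_val i j) (near_val j i) => na nb.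
set a := partial i _ x; set b := partial j _ x => ab0.
pose e := `|a - b| / 2; have e0 : 0 < e by rewrite divr_gt0.
have nearU : \forall y \near x, U y by exact: open_nbhs_nbhs.
have nn : \forall y \near x, [/\ U y, `|a - partial i (partial j f) y| < e &
                                      `|b - partial j (partial i f) y| < e].
  apply: filterS (filterI nearU (filterI (na e e0) (nb e e0))) => y [h1 [h2 h3]].
  exact: And3 h1 h2 h3.
have [r1 r10 P1] := near_plane 'e_i 'e_j nn.
have [r2 r20 P2] := near_plane 'e_j 'e_i nn.
pose r := Num.min r1 r2; have r0 : 0 < r by rewrite lt_min r10.
pose h := r / 2; have hr : 0 < h < r by rewrite divr_gt0//= /h; lra.
have rr1 : r <= r1 by rewrite ge_min lexx.
have rr2 : r <= r2 by rewrite ge_min lexx orbT.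
have [|s [t [sh th st]]] := @second_difference f i j x r h sf _ hr.
  by move=> s t sr tr; have [] := P1 s t (lt_le_trans sr rr1) (lt_le_trans tr rr1).
have [|s' [t' [sh' th' st']]] := @second_difference f j i x r h sf _ hr.
  by move=> s' t' sr tr; have [] := P2 s' t' (lt_le_trans sr rr2) (lt_le_trans tr rr2).
have [h0 hr'] := andP hr; have hlt := ltW hr'.
have [_ _ bp] := P1 s t (lt_le_trans sh (le_trans hlt rr1)) (lt_le_trans th (le_trans hlt rr1)).
have [_ aq _] := P2 s' t' (lt_le_trans sh' (le_trans hlt rr2)) (lt_le_trans th' (le_trans hlt rr2)).
have h00 : h != 0 by rewrite gt_eqF.
apply: (two_halves_lt h00 st st' _ bp aq).
by rewrite [x + _ + h *: 'e_i]addrAC; ring.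
Qed.

End Schwarz.

(** * Smooth complex functions *)

Section ComplexSmooth.
Variables (R : realType) (m : nat) (U : set 'rV[R]_m).
Hypothesis openU : open U.
Implicit Types (f g : 'rV[R]_m -> R[i]) (x : 'rV[R]_m).

Lemma csmooth_ext f g : {in U, f =1 g} -> csmooth_on U f -> csmooth_on U g.
Proof.
move=> fg [sr si]; split; apply: (smooth_algP openU).
- by apply: SmoothExt (SmoothBase sr) => x xU; rewrite fg.
- by apply: SmoothExt (SmoothBase si) => x xU; rewrite fg.
Qed.

Lemma csmooth_cst (z : R[i]) : csmooth_on U (fun=> z).
Proof. by split; apply: (smooth_algP openU); exact: SmoothCst. Qed.

Lemma csmooth_real (f : 'rV[R]_m -> R) : smooth_on U f ->
  csmooth_on U (fun x => real_complex R (f x)).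
Proof. by move=> sf; split=> //; exact: (csmooth_cst 0).2. Qed.

Lemma csmoothD f g : csmooth_on U f -> csmooth_on U g ->
  csmooth_on U (fun x => f x + g x).
Proof.
move=> [fr fi] [gr gi]; split; apply: (smooth_algP openU).
- by apply: SmoothExt (SmoothAdd (SmoothBase fr) (SmoothBase gr)) => x _;
  case: (f x) (g x) => ? ? [].
- by apply: SmoothExt (SmoothAdd (SmoothBase fi) (SmoothBase gi)) => x _;
  case: (f x) (g x) => ? ? [].
Qed.

Lemma csmoothM f g : csmooth_on U f -> csmooth_on U g ->
  csmooth_on U (fun x => f x * g x).
Proof.
move=> [/SmoothBase fr /SmoothBase fi] [/SmoothBase gr /SmoothBase gi].
split; apply: (smooth_algP openU).
(* Subtraction is not a constructor of [smooth_alg]; it enters as multiplication by -1. *)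
- apply: SmoothExt (SmoothAdd (SmoothMul fr gr) (SmoothMul (SmoothCst _ (-1)) (SmoothMul fi gi)))
  => x _.
  by case: (f x) (g x) => a b [c d] /=; rewrite mulN1r.
- apply: SmoothExt (SmoothAdd (SmoothMul fr gi) (SmoothMul fi gr)) => x _.
  by case: (f x) (g x) => a b [c d].
Qed.

Lemma csmooth_cpartial i f : csmooth_on U f -> csmooth_on U (cpartial i f).
Proof. by move=> [fr fi]; split; exact: smooth_partial. Qed.

Lemma eq_cpartial i f g x : {in U, f =1 g} -> U x -> cpartial i f x = cpartial i g x.
Proof.
by move=> fg Ux; rewrite /cpartial; congr (_ +i* _)%C; apply: (eq_partial openU) => // y yU;
  rewrite fg.
Qed.

Lemma cpartial_cst i (z : R[i]) x : cpartial i (fun=> z) x = 0.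
Proof. by rewrite /cpartial !partial_cst. Qed.

Lemma cpartial_real i (f : 'rV[R]_m -> R) x :
  cpartial i (fun y => real_complex R (f y)) x = real_complex R (partial i f x).
Proof. by rewrite /cpartial /= partial_cst. Qed.

Lemma cpartialD i f g x : csmooth_on U f -> csmooth_on U g -> U x ->
  cpartial i (fun y => f y + g y) x = cpartial i f x + cpartial i g x.
Proof.
move=> [fr fi] [gr gi] Ux; rewrite /cpartial /=.
have -> : (fun y => complex.Re (f y + g y)) = (fun y => complex.Re (f y) + complex.Re (g y)).
  by apply/funext => y; case: (f y) (g y) => ? ? [].
have -> : (fun y => complex.Im (f y + g y)) = (fun y => complex.Im (f y) + complex.Im (g y)).
  by apply/funext => y; case: (f y) (g y) => ? ? [].
by rewrite (partialD _ (smooth_differentiable fr Ux) (smooth_differentiable gr Ux))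
  (partialD _ (smooth_differentiable fi Ux) (smooth_differentiable gi Ux)).
Qed.

Lemma cpartialM i f g x : csmooth_on U f -> csmooth_on U g -> U x ->
  cpartial i (fun y => f y * g y) x = cpartial i f x * g x + f x * cpartial i g x.
Proof.
move=> [fr fi] [gr gi] Ux; rewrite /cpartial /=.
have e1 : (fun y => complex.Re (f y * g y)) =
    (fun y => complex.Re (f y) * complex.Re (g y) + (-1) * (complex.Im (f y) * complex.Im (g y))).
  by apply/funext => y; case: (f y) (g y) => ? ? [? ?]; rewrite mulN1r.
have e2 : (fun y => complex.Im (f y * g y)) =
    (fun y => complex.Re (f y) * complex.Im (g y) + complex.Im (f y) * complex.Re (g y)).
  by apply/funext => y; case: (f y) (g y) => ? ? [].
rewrite e1 e2.
have dfr := smooth_differentiable fr Ux; have dfi := smooth_differentiable fi Ux.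
have dgr := smooth_differentiable gr Ux; have dgi := smooth_differentiable gi Ux.
have dM (h k : 'rV[R]_m -> R) : differentiable h x -> differentiable k x ->
    differentiable (fun y => h y * k y) x.
  by move=> dh dk; exact: (@differentiableM _ _ h k).
have dc : differentiable (fun=> -1 : R) x by exact: differentiable_cst.
have dfg := dM _ _ dfi dgi; have dNfg := dM _ _ dc dfg.
rewrite !partialD ?partialM ?partial_cst//; try exact: dM.
case: (f x) (g x) => a b [c d] /=; simpc; congr (_ +i* _)%C; ring.
Qed.

Lemma cpartialC i j f x : csmooth_on U f -> U x ->
  cpartial i (cpartial j f) x = cpartial j (cpartial i f) x.
Proof.
move=> [fr fi] Ux.
exact: (f_equal2 (@Complex R) (partialC openU i j fr Ux) (partialC openU i j fi Ux)).
Qed.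

End ComplexSmooth.

(* The marked point makes the ring of smooth functions nontrivial. *)
Record domain (R : realType) (m : nat) := Domain {
  dset : set 'rV[R]_m;
  dpoint : 'rV[R]_m;
  dset_open : open dset;
  dset_point : dset dpoint
}.

(** * The ring of smooth complex functions on an open set *)

Section SmoothRing.
Variables (R : realType) (m : nat) (D : domain R m).
Let oD := @dset_open _ _ D.

(* Smooth functions on [D] are represented by their extension by zero, so that Leibniz equality is
   equality on [D]; the unit is therefore the indicator function of [D]. *)
Definition supported (f : 'rV[R]_m -> R[i]) : bool :=
  `[< csmooth_on (dset D) f /\ forall x, ~ dset D x -> f x = 0 >].

Record sfun := Sfun { sfun_val :> 'rV[R]_m -> R[i]; _ : supported sfun_val }.
HB.instance Definition _ := [isSub for sfun_val].
HB.instance Definition _ := [Choice of sfun by <:].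

Lemma sfun_smooth (a : sfun) : csmooth_on (dset D) a.
Proof. by have /asboolP[] := valP a. Qed.

Lemma sfun_ext (a b : sfun) : {in dset D, a =1 b} -> a = b.
Proof.
move=> ab; apply/val_inj/funext => x; have [Dx|nDx] := pselect (dset D x).
  by apply: ab; rewrite inE.
by have /asboolP[_ ->//] := valP a; have /asboolP[_ ->] := valP b.
Qed.

Definition cut (f : 'rV[R]_m -> R[i]) : 'rV[R]_m -> R[i] :=
  fun x => if `[< dset D x >] then f x else 0.

Lemma cutE f : {in dset D, cut f =1 f}.
Proof. by move=> x; rewrite inE => Dx; rewrite /cut asboolT. Qed.

Lemma cut_supported f : csmooth_on (dset D) f -> supported (cut f).
Proof.
move=> sf; apply/asboolP; split; last by move=> x nDx; rewrite /cut asboolF.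
by apply: (csmooth_ext oD) sf => x xD; rewrite cutE.
Qed.

Definition mk_sfun f (sf : csmooth_on (dset D) f) : sfun := Sfun (cut_supported sf).

Lemma mk_sfunE f (sf : csmooth_on (dset D) f) : {in dset D, mk_sfun sf =1 f}.
Proof. exact: cutE. Qed.

Definition sfun_cst (z : R[i]) := mk_sfun (csmooth_cst oD z).
Definition sfun_add (a b : sfun) := mk_sfun (csmoothD oD (sfun_smooth a) (sfun_smooth b)).
Definition sfun_mul (a b : sfun) := mk_sfun (csmoothM oD (sfun_smooth a) (sfun_smooth b)).
Definition sfun_opp (a : sfun) := sfun_mul (sfun_cst (-1)) a.

Let addE a b : {in dset D, sfun_add a b =1 (fun x => a x + b x)}.
Proof. exact: mk_sfunE. Qed.
Let mulE a b : {in dset D, sfun_mul a b =1 (fun x => a x * b x)}.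
Proof. exact: mk_sfunE. Qed.
Let cstE z : {in dset D, sfun_cst z =1 (fun=> z)}.
Proof. exact: mk_sfunE. Qed.
Let oppE a : {in dset D, sfun_opp a =1 (fun x => - a x)}.
Proof. by move=> x xD; rewrite mulE// cstE// mulN1r. Qed.

Let addA : associative sfun_add.
Proof. by move=> a b c; apply: sfun_ext => x xD; rewrite !addE// addrA. Qed.
Let addC : commutative sfun_add.
Proof. by move=> a b; apply: sfun_ext => x xD; rewrite !addE// addrC. Qed.
Let add0 : left_id (sfun_cst 0) sfun_add.
Proof. by move=> a; apply: sfun_ext => x xD; rewrite !addE// cstE// add0r. Qed.
Let addN : left_inverse (sfun_cst 0) sfun_opp sfun_add.
Proof. by move=> a; apply: sfun_ext => x xD; rewrite !addE// cstE// oppE// addNr. Qed.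

HB.instance Definition _ := GRing.isZmodule.Build sfun addA addC add0 addN.

Let mulA : associative sfun_mul.
Proof. by move=> a b c; apply: sfun_ext => x xD; rewrite !mulE// mulrA. Qed.
Let mulC : commutative sfun_mul.
Proof. by move=> a b; apply: sfun_ext => x xD; rewrite !mulE// mulrC. Qed.
Let mul1 : left_id (sfun_cst 1) sfun_mul.
Proof. by move=> a; apply: sfun_ext => x xD; rewrite !mulE// cstE// mul1r. Qed.
Let mulDl : left_distributive sfun_mul +%R.
Proof. by move=> a b c; apply: sfun_ext => x xD; rewrite mulE// !addE// !mulE// mulrDl. Qed.
Let one_neq0 : sfun_cst 1 != 0.
Proof.
apply/eqP => /(congr1 (fun a : sfun => a (dpoint D))).
have pD : dpoint D \in dset D by rewrite inE; exact: dset_point.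
by rewrite !cstE// => /eqP; rewrite oner_eq0.
Qed.

HB.instance Definition _ :=
  GRing.Zmodule_isComNzRing.Build sfun mulA mulC mul1 mulDl one_neq0.

(** The point is taken in the subtype of [dset D]: outside, the unit of the ring evaluates to 0 and
    evaluation is no ring morphism. These morphisms are jointly injective, which reduces identities
    in the ring to pointwise ones. *)
Definition sfun_eval (x : {x | dset D x}) (a : sfun) : R[i] := a (sval x).

Arguments sfun_eval : simpl never.

Let inD (x : {x | dset D x}) : sval x \in dset D.
Proof. by rewrite inE; exact: svalP. Qed.

Lemma sfun_eval_nmod x : nmod_morphism (sfun_eval x).
Proof. by split=> [|a b]; rewrite /sfun_eval ?cstE ?addE. Qed.
HB.instance Definition _ x :=
  GRing.isNmodMorphism.Build sfun R[i] (sfun_eval x) (sfun_eval_nmod x).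

Lemma sfun_eval_monoid x : monoid_morphism (sfun_eval x).
Proof. by split=> [|a b]; rewrite /sfun_eval ?cstE ?mulE. Qed.
HB.instance Definition _ x :=
  GRing.isMonoidMorphism.Build sfun R[i] (sfun_eval x) (sfun_eval_monoid x).

Lemma sfun_evalP (a b : sfun) : (forall x, sfun_eval x a = sfun_eval x b) -> a = b.
Proof. by move=> ab; apply: sfun_ext => x /set_mem Dx; exact: (ab (exist _ x Dx)). Qed.

Definition sder (i : 'I_m) (a : sfun) : sfun := mk_sfun (csmooth_cpartial i (sfun_smooth a)).

Lemma sfun_eval_der x i a : sfun_eval x (sder i a) = cpartial i a (sval x).
Proof. exact: mk_sfunE. Qed.

Lemma sfun_eval_cst x z : sfun_eval x (sfun_cst z) = z.
Proof. exact: cstE. Qed.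

Lemma sderD i : {morph sder i : a b / a + b}.
Proof.
move=> a b; apply: sfun_evalP => x; rewrite rmorphD/= !sfun_eval_der.
rewrite -(cpartialD _ (sfun_smooth a) (sfun_smooth b) (svalP x)).
by apply: (eq_cpartial oD) (svalP x) => y yD; rewrite addE.
Qed.

Lemma sderM i a b : sder i (a * b) = sder i a * b + a * sder i b.
Proof.
apply: sfun_evalP => x; rewrite rmorphD/= !rmorphM/= !sfun_eval_der.
rewrite -[sfun_eval x a]/(a (sval x)) -[sfun_eval x b]/(b (sval x)).
rewrite -(cpartialM _ (sfun_smooth a) (sfun_smooth b) (svalP x)).
by apply: (eq_cpartial oD) (svalP x) => y yD; rewrite mulE.
Qed.

Lemma sderC i j a : sder i (sder j a) = sder j (sder i a).
Proof.
apply: sfun_evalP => x; rewrite !sfun_eval_der.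
have e k l : cpartial k (sder l a) (sval x) = cpartial k (cpartial l a) (sval x).
  by apply: (eq_cpartial oD) (svalP x); exact: mk_sfunE.
by rewrite !e; exact: (cpartialC oD) (sfun_smooth a) (svalP x).
Qed.

End SmoothRing.

#[global] Arguments sfun_eval : simpl never.

(** * Tensor calculus over a ring with commuting derivations *)

Section Contract.
Variables (K : comNzRingType) (m : nat).
Implicit Types (a b X Y : 'rV[K]_m) (z : K).

Lemma contractE a X : contract a X = (a *m X^T) 0 0.
Proof. by rewrite mxE; apply: eq_bigr => i _; rewrite mxE. Qed.

Lemma contract_mx a X : a *m X^T = (contract a X)%:M.
Proof. by apply/matrixP => i j; rewrite !ord1 contractE [RHS]mxE mulr1n. Qed.

Lemma contractC a X : contract a X = contract X a.
Proof. by apply: eq_bigr => i _; rewrite mulrC. Qed.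

Lemma contractDl a b X : contract (a + b) X = contract a X + contract b X.
Proof. by rewrite !contractE mulmxDl mxE. Qed.
Lemma contractNl a X : contract (- a) X = - contract a X.
Proof. by rewrite !contractE mulNmx mxE. Qed.
Lemma contractBl a b X : contract (a - b) X = contract a X - contract b X.
Proof. by rewrite contractDl contractNl. Qed.
Lemma contractZl z a X : contract (z *: a) X = z * contract a X.
Proof. by rewrite !contractE -scalemxAl mxE. Qed.
Lemma contract0l X : contract 0 X = 0.
Proof. by rewrite !contractE mul0mx mxE. Qed.
Lemma contractDr a X Y : contract a (X + Y) = contract a X + contract a Y.
Proof. by rewrite contractC contractDl !(contractC a). Qed.
Lemma contractNr a X : contract a (- X) = - contract a X.
Proof. by rewrite contractC contractNl contractC. Qed.
Lemma contractBr a X Y : contract a (X - Y) = contract a X - contract a Y.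
Proof. by rewrite contractDr contractNr. Qed.
Lemma contractZr z a X : contract a (z *: X) = z * contract a X.
Proof. by rewrite contractC contractZl contractC. Qed.
Lemma contract0r a : contract a 0 = 0.
Proof. by rewrite contractC contract0l. Qed.

Lemma contract_sumr (I : finType) a (X : I -> 'rV[K]_m) :
  contract a (\sum_i X i) = \sum_i contract a (X i).
Proof.
apply: (big_ind2 (fun u v => contract a u = v)) => [|u v w z <- <-|//].
  exact: contract0r.
exact: contractDr.
Qed.

Lemma contract_mulmxl a (A : 'M[K]_m) X : contract (a *m A) X = contract a (X *m A^T).
Proof. by rewrite !contractE trmx_mul trmxK mulmxA. Qed.

Lemma contract_delta a i : contract a (delta_mx 0 i) = a 0 i.
Proof.
rewrite /contract (bigD1 i)//= big1 => [|j ji]; first by rewrite mxE !eqxx mulr1 addr0.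
by rewrite mxE eqxx (negPf ji) mulr0.
Qed.

Lemma contract_ext a b : (forall X, contract a X = contract b X) -> a = b.
Proof. by move=> ab; apply/rowP => i; rewrite -!contract_delta ab. Qed.

End Contract.

Section MatrixCalculus.
Variables (K : comNzRingType) (m : nat) (d : 'I_m -> K -> K).
Hypothesis dD : forall i, {morph d i : a b / a + b}.
Hypothesis dM : forall i a b, d i (a * b) = d i a * b + a * d i b.
Hypothesis dC : forall i j a, d i (d j a) = d j (d i a).
Implicit Types (X Y Z a b : 'rV[K]_m) (f g z : K).

Lemma der0 i : d i 0 = 0.
Proof. by apply: (addrI (d i 0)); rewrite -dD !addr0. Qed.
Lemma derN i : {morph d i : a / - a}.
Proof. by move=> f; apply: (addrI (d i f)); rewrite -dD !subrr der0. Qed.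
Lemma der_sum i (I : finType) (F : I -> K) : d i (\sum_k F k) = \sum_k d i (F k).
Proof. exact: (big_morph (d i) (dD i) (der0 i)). Qed.
Definition along X f : K := \sum_k X 0 k * d k f.
Definition alongm X p q (A : 'M[K]_(p, q)) : 'M[K]_(p, q) :=
  \matrix_(i, j) along X (A i j).
Definition jacm q (Y : 'rV[K]_q) : 'M[K]_(m, q) := \matrix_(i, j) d i (Y 0 j).
Definition grad f : 'rV[K]_m := \row_i d i f.
Definition lie_bracket X Y := X *m jacm Y - Y *m jacm X.

Lemma alongD X f g : along X (f + g) = along X f + along X g.
Proof. by rewrite -big_split/=; apply: eq_bigr => k _; rewrite dD mulrDr. Qed.
Lemma alongN X f : along X (- f) = - along X f.
Proof. by rewrite -sumrN; apply: eq_bigr => k _; rewrite derN mulrN. Qed.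
Lemma alongB X f g : along X (f - g) = along X f - along X g.
Proof. by rewrite alongD alongN. Qed.
Lemma along0 X : along X 0 = 0.
Proof. by rewrite /along big1// => k _; rewrite der0 mulr0. Qed.
Lemma alongM X f g : along X (f * g) = along X f * g + f * along X g.
Proof.
rewrite mulr_suml mulr_sumr -big_split/=; apply: eq_bigr => k _.
by rewrite dM; ring.
Qed.
Lemma along_sum X (I : finType) (F : I -> K) : along X (\sum_k F k) = \sum_k along X (F k).
Proof. exact: (big_morph (along X) (alongD X) (along0 X)). Qed.
Lemma alongDl X Y f : along (X + Y) f = along X f + along Y f.
Proof. by rewrite -big_split/=; apply: eq_bigr => k _; rewrite mxE mulrDl. Qed.
Lemma alongNl X f : along (- X) f = - along X f.
Proof. by rewrite -sumrN; apply: eq_bigr => k _; rewrite mxE mulNr. Qed.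
Lemma alongBl X Y f : along (X - Y) f = along X f - along Y f.
Proof. by rewrite alongDl alongNl. Qed.
Lemma alongE X f : along X f = contract (grad f) X.
Proof. by apply: eq_bigr => k _; rewrite mxE mulrC. Qed.

Lemma alongmD X p q (A B : 'M[K]_(p, q)) : alongm X (A + B) = alongm X A + alongm X B.
Proof. by apply/matrixP => i j; rewrite !mxE alongD. Qed.
Lemma alongmN X p q (A : 'M[K]_(p, q)) : alongm X (- A) = - alongm X A.
Proof. by apply/matrixP => i j; rewrite !mxE alongN. Qed.
Lemma alongmB X p q (A B : 'M[K]_(p, q)) : alongm X (A - B) = alongm X A - alongm X B.
Proof. by rewrite alongmD alongmN. Qed.
Lemma alongmZ X p q f (A : 'M[K]_(p, q)) :
  alongm X (f *: A) = along X f *: A + f *: alongm X A.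
Proof. by apply/matrixP => i j; rewrite !mxE alongM. Qed.
Lemma alongm_tr X p q (A : 'M[K]_(p, q)) : alongm X A^T = (alongm X A)^T.
Proof. by apply/matrixP => i j; rewrite !mxE. Qed.
Lemma alongmM X p q r (A : 'M[K]_(p, q)) (B : 'M[K]_(q, r)) :
  alongm X (A *m B) = alongm X A *m B + A *m alongm X B.
Proof.
apply/matrixP => i j; rewrite !mxE along_sum -big_split/=.
by apply: eq_bigr => k _; rewrite !mxE alongM.
Qed.
Lemma alongm_row X q (Y : 'rV[K]_q) : alongm X Y = X *m jacm Y.
Proof.
by apply/rowP => j; rewrite !mxE; apply: eq_bigr => k _; rewrite mxE.
Qed.

Lemma braE X Y : lie_bracket X Y = alongm X Y - alongm Y X.
Proof. by rewrite !alongm_row. Qed.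

Lemma braN X Y : lie_bracket X Y = - lie_bracket Y X.
Proof. by rewrite /lie_bracket opprB. Qed.

Lemma along_contract X a Y :
  along X (contract a Y) = contract (alongm X a) Y + contract a (alongm X Y).
Proof.
rewrite along_sum -big_split/=; apply: eq_bigr => k _.
by rewrite alongM !mxE.
Qed.

Lemma gradD f g : grad (f + g) = grad f + grad g.
Proof. by apply/rowP => i; rewrite !mxE dD. Qed.
Lemma gradN f : grad (- f) = - grad f.
Proof. by apply/rowP => i; rewrite !mxE derN. Qed.
Lemma gradB f g : grad (f - g) = grad f - grad g.
Proof. by rewrite gradD gradN. Qed.
Lemma grad0 : grad 0 = 0.
Proof. by apply/rowP => i; rewrite !mxE der0. Qed.
Lemma gradM f g : grad (f * g) = g *: grad f + f *: grad g.
Proof. by apply/rowP => i; rewrite !mxE dM mulrC. Qed.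
Lemma grad_contract a Y :
  grad (contract a Y) = Y *m (jacm a)^T + a *m (jacm Y)^T.
Proof.
apply/rowP => i; rewrite !mxE der_sum -big_split/=; apply: eq_bigr => k _.
by rewrite dM !mxE; ring.
Qed.

Lemma jacmD q (Y Z : 'rV[K]_q) : jacm (Y + Z) = jacm Y + jacm Z.
Proof. by apply/matrixP => i j; rewrite !mxE dD. Qed.
Lemma jacmN q (Y : 'rV[K]_q) : jacm (- Y) = - jacm Y.
Proof. by apply/matrixP => i j; rewrite !mxE derN. Qed.
Lemma jacmZ q f (Y : 'rV[K]_q) : jacm (f *: Y) = f *: jacm Y + (grad f)^T *m Y.
Proof.
apply/matrixP => i j; rewrite !mxE dM big_ord1 !mxE; ring.
Qed.

(** A second-order derivative [along U (along V f)] splits into a first-order part and a Hessian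
    part; the latter is symmetric by [dC] and cancels in the commutator. *)
Lemma along_bra X Y f : along (lie_bracket X Y) f = along X (along Y f) - along Y (along X f).
Proof.
have e U V : along U (along V f) =
    along (alongm U V) f + \sum_j \sum_k U 0 j * V 0 k * d j (d k f).
  transitivity (\sum_j \sum_k (U 0 j * d j (V 0 k) * d k f + U 0 j * V 0 k * d j (d k f))).
    apply: eq_bigr => j _; rewrite der_sum mulr_sumr; apply: eq_bigr => k _.
    by rewrite dM; ring.
  under eq_bigr do rewrite big_split/=.
  rewrite big_split/= exchange_big/=; congr (_ + _).
  by apply: eq_bigr => k _; rewrite mxE mulr_suml.
rewrite !e braE alongBl [X in _ = _ + _ - (_ + X)]exchange_big/=.
rewrite [X in _ = _ + _ - (_ + X)](_ : _ = \sum_j \sum_k X 0 j * Y 0 k * d j (d k f)).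
  by ring.
by apply: eq_bigr => j _; apply: eq_bigr => k _; rewrite (dC k j) (mulrC (X 0 j)).
Qed.

Lemma alongm_bra X Y p q (A : 'M[K]_(p, q)) :
  alongm (lie_bracket X Y) A = alongm X (alongm Y A) - alongm Y (alongm X A).
Proof. by apply/matrixP => i j; rewrite !mxE along_bra. Qed.

Lemma jacm_mul X Y : jacm (X *m jacm Y) = jacm X *m jacm Y + alongm X (jacm Y).
Proof.
apply/matrixP => i j; rewrite !mxE der_sum /along -big_split/=; apply: eq_bigr => k _.
by rewrite !mxE dM dC.
Qed.

Lemma jacm_bra X Y : jacm (lie_bracket X Y) =
  alongm X (jacm Y) - alongm Y (jacm X) + jacm X *m jacm Y - jacm Y *m jacm X.
Proof.
rewrite jacmD jacmN !jacm_mul opprD; set a := _ *m _; set c := _ *m _.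
rewrite [a + _]addrC -!addrA; congr (_ + _).
by rewrite [RHS]addrCA; congr (_ + _); rewrite addrC.
Qed.

(** By [alongm_bra] each double bracket expands into four iterated derivatives, and the twelve terms
    cancel in pairs. *)
Lemma bra_jacobi X Y Z : lie_bracket X (lie_bracket Y Z) + lie_bracket Y (lie_bracket Z X)
  + lie_bracket Z (lie_bracket X Y) = 0.
Proof.
have e U V W : lie_bracket U (lie_bracket V W) = alongm U (alongm V W) - alongm U (alongm W V)
   - (alongm V (alongm W U) - alongm W (alongm V U)).
  by rewrite [LHS]braE alongm_bra [lie_bracket V W]braE alongmB.
by rewrite !e; apply/matrixP => i j; rewrite !mxE; ring.
Qed.

(* A solution of [d i (T k j) = d k (T i j)] is the Jacobian of a change of coordinates. *)
Lemma jacm_mul_curlfree Y (T : 'M[K]_m) :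
  (forall i j k, d i (T k j) = d k (T i j)) -> jacm (Y *m T) = jacm Y *m T + alongm Y T.
Proof.
move=> sT; apply/matrixP => i j; rewrite !mxE der_sum /along -big_split/=.
by apply: eq_bigr => k _; rewrite !mxE dM sT.
Qed.

Lemma mul_alongm_curlfree X Y (T : 'M[K]_m) :
  (forall i j k, d i (T k j) = d k (T i j)) -> X *m alongm Y T = Y *m alongm X T.
Proof.
move=> sT; apply/rowP => j; rewrite !mxE.
under eq_bigr do rewrite mxE mulr_sumr.
under [RHS]eq_bigr do rewrite mxE mulr_sumr.
rewrite exchange_big/=; apply: eq_bigr => k _; apply: eq_bigr => l _.
by rewrite sT; ring.
Qed.

(** Naturality of the Lie bracket under a change of coordinates with Jacobian [T]: the terms that
    differentiate [T] are symmetric in [X] and [Y], hence cancel. *)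
Lemma bra_curlfree X Y (T : 'M[K]_m) : (forall i j k, d i (T k j) = d k (T i j)) ->
  X *m jacm (Y *m T) - Y *m jacm (X *m T) = lie_bracket X Y *m T.
Proof.
move=> sT; rewrite !jacm_mul_curlfree// !mulmxDr (mul_alongm_curlfree X Y sT).
by rewrite opprD addrACA subrr addr0 mulmxBl !mulmxA.
Qed.

End MatrixCalculus.

Section MatrixEntries.
Variables (K : comNzRingType) (p q : nat).
Implicit Types A B : 'M[K]_(p, q).

Lemma addmxE A B i j : (A + B) i j = A i j + B i j. Proof. by rewrite mxE. Qed.
Lemma oppmxE A i j : (- A) i j = - A i j. Proof. by rewrite mxE. Qed.
Lemma scalemxE z A i j : (z *: A) i j = z * A i j. Proof. by rewrite mxE. Qed.
Lemma zeromxE i j : (0 : 'M[K]_(p, q)) i j = 0. Proof. by rewrite mxE. Qed.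

Lemma trmxD A B : (A + B)^T = A^T + B^T. Proof. by apply/matrixP => i j; rewrite !mxE. Qed.
Lemma trmxN A : (- A)^T = - A^T. Proof. by apply/matrixP => i j; rewrite !mxE. Qed.
Lemma trmxB A B : (A - B)^T = A^T - B^T. Proof. by rewrite trmxD trmxN. Qed.
Lemma trmxZ z A : (z *: A)^T = z *: A^T. Proof. by apply/matrixP => i j; rewrite !mxE. Qed.

End MatrixEntries.

(** Entrywise [ring], with matrix products and Jacobians as atoms; products must be distributed
    beforehand. *)
Ltac mxring :=
  let i := fresh in let j := fresh in
  apply/matrixP => i j; rewrite ?(addmxE, oppmxE, scalemxE, zeromxE); ring.

Section NormalForm.
Variables (K : comNzRingType) (m : nat).
Implicit Types (eta F : 'rV[K]_m) (theta pi : 'M[K]_m) (u v : gfib K m) (s : K).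

(* The four bundles of the theorem are, with [s = - i] for [L], [E^(1,0)] and
   [s = i] for [L^*], [E^(0,1)], the graphs of [s theta] over [TM] ([p = false]) or
   [ker eta] ([p = true]), to which [L_eta] is added when [q = false]. *)
Definition normal_form theta eta F s (p q : bool) u : Prop :=
  [/\ u.2 = s *: (u.1 *m theta) + contract u.2 F *: eta,
      p -> contract eta u.1 = 0 & q -> contract u.2 F = 0].

End NormalForm.

(** * The Courant bracket on graphs of closed forms *)

Section CourantAlgebra.
Variables (K : comNzRingType) (m : nat) (d : 'I_m -> K -> K).
Hypothesis dD : forall i, {morph d i : a b / a + b}.
Hypothesis dM : forall i a b, d i (a * b) = d i a * b + a * d i b.
Hypothesis dC : forall i j a, d i (d j a) = d j (d i a).
Variable half : K.
Hypothesis halfD : half + half = 1.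
Implicit Types (X Y Z a b : 'rV[K]_m) (f g z s : K) (u v w : gfib K m) (p q : bool).

Local Notation along := (along d).
Local Notation alongm := (alongm d).
Local Notation jacm := (jacm d).
Local Notation grad := (grad d).
Local Notation lie_bracket := (lie_bracket d).

(** Coordinate formulas for the Lie derivative, with [jacm X] having entries [d i (X 0 j)]: each
    covariant slot contributes a Jacobian term with a plus sign, each contravariant slot one with a
    minus sign. *)
Definition lie_form X b := X *m jacm b + b *m (jacm X)^T.
Definition lie_two_form X (Q : 'M[K]_m) := alongm X Q + jacm X *m Q + Q *m (jacm X)^T.
Definition lie_bivector X (Q : 'M[K]_m) := alongm X Q - (jacm X)^T *m Q - Q *m jacm X.

Definition courant_mx u v : gfib K m :=
  (lie_bracket u.1 v.1,
   lie_form u.1 v.2 - lie_form v.1 u.2 - half *: grad (contract v.2 u.1 - contract u.2 v.1)).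

Definition gpair u v : K := half * (contract v.2 u.1 + contract u.2 v.1).

Lemma lieD X a b : lie_form X (a + b) = lie_form X a + lie_form X b.
Proof. by rewrite /lie_form jacmD// mulmxDr mulmxDl addrACA. Qed.

Lemma lieZ X f a : lie_form X (f *: a) = along X f *: a + f *: lie_form X a.
Proof.
rewrite /lie_form jacmZ// mulmxDr -scalemxAr -scalemxAl scalerDr addrAC [RHS]addrC.
congr (_ + _); rewrite mulmxA contract_mx contractC -alongE mul_scalar_mx//.
Qed.

Lemma liefD X Y a : lie_form (X + Y) a = lie_form X a + lie_form Y a.
Proof. by rewrite /lie_form jacmD// trmxD mulmxDr mulmxDl addrACA. Qed.

Lemma liefZ f X a : lie_form (f *: X) a = f *: lie_form X a + contract a X *: grad f.
Proof.
rewrite /lie_form jacmZ// trmxD trmxZ mulmxDr -scalemxAl -scalemxAr addrA -scalerDr.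
by congr (_ + _); rewrite trmx_mul trmxK mulmxA contract_mx mul_scalar_mx.
Qed.

Lemma liebD X P Q : lie_bivector X (P + Q) = lie_bivector X P + lie_bivector X Q.
Proof. by rewrite /lie_bivector alongmD// mulmxDr mulmxDl; mxring. Qed.

Lemma liebN X Q : lie_bivector X (- Q) = - lie_bivector X Q.
Proof. by rewrite /lie_bivector alongmN// mulmxN mulNmx; mxring. Qed.

Lemma lieb_sum X (I : finType) (Q : I -> 'M[K]_m) :
  lie_bivector X (\sum_k Q k) = \sum_k lie_bivector X (Q k).
Proof.
apply: (big_morph (lie_bivector X) (liebD X)).
by apply: (addrI (lie_bivector X 0)); rewrite -liebD !addr0.
Qed.

Lemma liebZ X s Q : (forall i, d i s = 0) -> lie_bivector X (s *: Q) = s *: lie_bivector X Q.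
Proof.
move=> ds; rewrite /lie_bivector alongmZ// -scalemxAl -scalemxAr !scalerBr.
by rewrite [along _ _]big1 ?scale0r ?add0r// => k _; rewrite ds mulr0.
Qed.

Lemma lieb_tensor X a b : lie_bivector X (a^T *m b)
  = (lie_bracket X a)^T *m b + a^T *m lie_bracket X b.
Proof.
rewrite /lie_bivector alongmM// alongm_tr !braE// trmxB mulmxBl mulmxBr !alongm_row.
rewrite !trmx_mul !mulmxA; mxring.
Qed.

Lemma lieb_bra X Y Q : lie_bivector (lie_bracket X Y) Q
  = lie_bivector X (lie_bivector Y Q) - lie_bivector Y (lie_bivector X Q).
Proof.
rewrite /lie_bivector alongm_bra// jacm_bra// !alongmB// !alongmM// !alongm_tr.
rewrite !(trmxD, trmxN) !trmx_mul.
rewrite !(mulmxDl, mulmxDr, mulmxBl, mulmxBr, mulNmx, mulmxN, mulmxA).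
mxring.
Qed.

Lemma cou_antisym u v : courant_mx u v = - courant_mx v u.
Proof.
apply/pair_equal_spec; split; rewrite /courant_mx/=; first exact: braN.
by rewrite !gradB//; mxring.
Qed.

Lemma couD u v w : courant_mx w (u + v) = courant_mx w u + courant_mx w v.
Proof.
apply/pair_equal_spec; split; rewrite /courant_mx/=.
  by rewrite /lie_bracket jacmD// mulmxDr mulmxDl; mxring.
rewrite lieD liefD !(contractDl, contractDr) !(gradB, gradD)//; mxring.
Qed.

(* The last term vanishes on isotropic subbundles. *)
Lemma cou_leibniz u v f :
  courant_mx u (f *: v) = f *: courant_mx u v + along u.1 f *: v - gpair u v *: (0, grad f).
Proof.
apply/pair_equal_spec; split; rewrite /courant_mx/= ?scaler0 ?subr0.
  rewrite /lie_bracket jacmZ// mulmxDr -!scalemxAl -scalemxAr mulmxA contract_mx mul_scalar_mx.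
  by rewrite contractC -alongE; mxring.
rewrite lieZ// liefZ// contractZl contractZr -mulrBr gradM//.
rewrite /gpair; set g := grad (_ - _); set h := grad f.
set a := contract u.2 v.1; set b := contract v.2 u.1.
apply/rowP => i; rewrite !(addmxE, oppmxE, scalemxE).
(* The coefficient of [h] is [- a - half * (b - a)]. Only after [a] is split into halves can [ring]
   identify it with [- half * (a + b)]. *)
have e : a = half * a + half * a by rewrite -mulrDl halfD mul1r.
by rewrite {1}e; ring.
Qed.

Variables (theta : 'M[K]_m) (eta F : 'rV[K]_m).
Hypothesis eta_closed : forall i j, d i (eta 0 j) = d j (eta 0 i).
Hypothesis theta_alt : theta^T = - theta.
Hypothesis theta_closed : forall i j k,
  d i (theta j k) + d j (theta k i) + d k (theta i j) = 0.
Hypothesis etaF : contract eta F = 1.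
Hypothesis Ftheta : F *m theta = 0.

Lemma theta_swap i j : theta i j = - theta j i.
Proof. by move/matrixP: theta_alt => /(_ j i); rewrite !mxE. Qed.

Lemma contract_thetaC X Y : contract (X *m theta) Y = - contract (Y *m theta) X.
Proof. by rewrite contract_mulmxl theta_alt mulmxN contractNr contractC. Qed.

Lemma contract_thetaF X : contract (X *m theta) F = 0.
Proof. by rewrite contract_thetaC Ftheta contract0l oppr0. Qed.

(** Cartan's formula, with the term [i_X d eta] removed by closedness. *)
Lemma lie_eta X : lie_form X eta = grad (contract eta X).
Proof.
rewrite grad_contract//; congr (_ *m _ + _).
by apply/matrixP => i j; rewrite !mxE eta_closed.
Qed.

(** Cartan's formula again: [jacm a - (jacm a)^T] is the matrix of the exterior derivative of [a],
    taken at [a = i_X theta], and [d theta = 0]. *)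
Lemma lie2_theta X : lie_two_form X theta = jacm (X *m theta) - (jacm (X *m theta))^T.
Proof.
apply/matrixP => j k; rewrite !mxE !der_sum// -sumrB -!big_split/=.
apply: eq_bigr => i _; rewrite !mxE !dM.
have := theta_closed i j k; rewrite [theta k i]theta_swap derN// => e0.
have -> : d i (theta j k) = d j (theta i k) - d k (theta i j).
  by rewrite -[LHS]subr0 -e0; ring.
by rewrite (theta_swap j i); ring.
Qed.

Lemma lie_mul_theta X Y : lie_form X (Y *m theta)
  = lie_bracket X Y *m theta + Y *m lie_two_form X theta.
Proof.
rewrite /lie_form -alongm_row alongmM// braE mulmxBl !alongm_row /lie_two_form !mulmxDr !mulmxA.
mxring.
Qed.

(** This is the symmetry of the Courant bracket under shears by a closed 2-form. As [theta] is
    alternating, the two contractions combine to twice one of them, absorbing [half]; what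
    [lie2_theta] leaves over then cancels. *)
Lemma lie_theta_bracket X Y : lie_form X (Y *m theta) - lie_form Y (X *m theta)
    - half *: grad (contract (Y *m theta) X - contract (X *m theta) Y)
  = lie_bracket X Y *m theta.
Proof.
rewrite contract_thetaC -opprD gradN// gradD// scalerN opprK scalerDr -scalerDl.
rewrite halfD scale1r grad_contract//.
rewrite lie_mul_theta lie2_theta mulmxBr /lie_form.
mxring.
Qed.

Definition graph s X z : gfib K m := (X, s *: (X *m theta) + z *: eta).

Lemma contract_graphF s X z : contract (graph s X z).2 F = z.
Proof. by rewrite contractDl !contractZl contract_thetaF etaF mulr0 add0r mulr1. Qed.

(** The disjunction kills the cross terms [z eta(Y)] and [z' eta(X)] together with [z d(eta(Y))] and
    [z' d(eta(X))], which would otherwise leave the graph form. Constancy of [s] lets it pass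
    through all derivatives. *)
Lemma cou_graph s X Y z z' : (forall i, d i s = 0) ->
  contract eta X = 0 /\ contract eta Y = 0 \/ z = 0 /\ z' = 0 ->
  courant_mx (graph s X z) (graph s Y z') = graph s (lie_bracket X Y) (along X z' - along Y z).
Proof.
move=> ds H; apply/pair_equal_spec; split => //=.
have as0 V : along V s = 0 by rewrite /along big1// => k _; rewrite ds mulr0.
have gs0 : grad s = 0 by apply/rowP => i; rewrite !mxE ds.
rewrite !lieD// !lieZ// !as0 !scale0r !add0r !lie_eta.
rewrite -lie_theta_bracket !contractDl !contractZl.
have -> : z * contract eta Y = 0 by case: H => [] [h1 h2]; rewrite ?h1 ?h2 ?mulr0 ?mul0r.
have -> : z' * contract eta X = 0 by case: H => [] [h1 h2]; rewrite ?h1 ?h2 ?mulr0 ?mul0r.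
have -> : z *: grad (contract eta Y) = 0.
  by case: H => [] [h1 h2]; rewrite ?h1 ?h2 ?grad0 ?scaler0 ?scale0r.
have -> : z' *: grad (contract eta X) = 0.
  by case: H => [] [h1 h2]; rewrite ?h1 ?h2 ?grad0 ?scaler0 ?scale0r.
rewrite !addr0 -mulrBr gradM// gs0 scaler0 add0r.
mxring.
Qed.

(** Another form of [d eta = 0]; it makes [ker eta] involutive. *)
Lemma contract_eta_bra X Y :
  contract eta (lie_bracket X Y) = along X (contract eta Y) - along Y (contract eta X).
Proof.
rewrite !along_contract// braE contractBr !alongm_row.
have -> : contract (X *m jacm eta) Y = contract (Y *m jacm eta) X.
  rewrite contract_mulmxl contractC; congr (contract (_ *m _) _).
  by apply/matrixP => i j; rewrite !mxE eta_closed.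
ring.
Qed.

Section NormalFormBracket.
Variables (s : K) (p q : bool).
Hypothesis ds : forall i, d i s = 0.
Hypothesis pq : p || q.
Local Notation nf := (normal_form theta eta F s p q).

Lemma nf_graph u : nf u -> u = graph s u.1 (contract u.2 F).
Proof. by case: u => X a [/= e _ _]; rewrite {1}e. Qed.

(** [p || q] excludes the sum of a graph over the whole tangent bundle and the line of [eta], which
    is not isotropic. *)
Lemma nf_cases u v : nf u -> nf v ->
  contract eta u.1 = 0 /\ contract eta v.1 = 0 \/
  contract u.2 F = 0 /\ contract v.2 F = 0.
Proof. by move=> [_ up uq] [_ vp vq]; case/orP: pq => h; [left|right]; auto. Qed.

Lemma nf_cou_graph u v : nf u -> nf v ->
  courant_mx u v = graph s (lie_bracket u.1 v.1) (along u.1 (contract v.2 F) - along v.1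
    (contract u.2 F)).
Proof.
move=> nu nv; rewrite -cou_graph//; last exact: nf_cases.
by rewrite -!nf_graph.
Qed.

Lemma nf_cou u v : nf u -> nf v -> nf (courant_mx u v).
Proof.
move=> nu nv; rewrite nf_cou_graph//; case: nu nv => [_ up uq] [_ vp vq].
split; rewrite ?contract_graphF//= => h.
- by rewrite contract_eta_bra up// vp// !along0// subr0.
- by rewrite uq// vq// !along0// subr0.
Qed.

Lemma nf_isotropic u v : nf u -> nf v -> gpair u v = 0.
Proof.
move=> nu nv; have := nf_cases nu nv; rewrite (nf_graph nu) (nf_graph nv).
rewrite /gpair !contract_graphF /= !contractDl !contractZl (contract_thetaC v.1).
by case=> [] [-> ->]; ring.
Qed.

(** In graph form the identity splits into the Jacobi identity for the vector parts and, for the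
    [eta]-coefficients, a cancellation of iterated derivatives given by [along_bra]. *)
Lemma nf_jacobi u v w : nf u -> nf v -> nf w ->
  courant_mx u (courant_mx v w) + courant_mx v (courant_mx w u) + courant_mx w (courant_mx u v) = 0.
Proof.
move=> nu nv nw.
rewrite (nf_cou_graph nu (nf_cou nv nw)) (nf_cou_graph nv (nf_cou nw nu)).
rewrite (nf_cou_graph nw (nf_cou nu nv)) !nf_cou_graph// !contract_graphF.
rewrite !along_bra// !alongB//; have := bra_jacobi dD dM dC u.1 v.1 w.1.
move: (lie_bracket u.1 _) (lie_bracket v.1 (lie_bracket _ _)) (lie_bracket w.1 (lie_bracket _ _))
  => A B C e.
apply/pair_equal_spec; split; rewrite //=.
have -> : C = - (A + B) by apply/eqP; rewrite -subr_eq0 opprK addrC e.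
rewrite !(mulmxDl, mulNmx); mxring.
Qed.

End NormalFormBracket.

(** * The dual differential as a Lie derivative of the bivector *)

Section Bialgebroid.
Variables (pi : 'M[K]_m) (ii : K).
Hypothesis pi_alt : pi^T = - pi.
Hypothesis eta_pi : eta *m pi = 0.
Hypothesis theta_pi : theta *m pi = eta^T *m F - 1%:M.
Hypothesis ii2 : ii * ii = -1.
Hypothesis dii : forall i, d i ii = 0.
Hypothesis dhalf : forall i, d i half = 0.
Implicit Types (xi zeta : gfib K m).

(** The functional that [xi] induces through the pairing on the graph of [- ii theta], read as a
    1-form (see [pair_graphN]); [lift] is its inverse onto the sections whose vector part lies in
    [ker eta]. The factor [half] in the pairing makes the [eta]-coefficient of [lift a] equal to
    twice [a(F)]. *)
Definition covector_of xi : 'rV[K]_m := half *: (xi.2 + ii *: (xi.1 *m theta)).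
Definition lift a : gfib K m := (ii *: (a *m pi), a + contract a F *: eta).

Lemma pi_theta : pi *m theta = F^T *m eta - 1%:M.
Proof.
rewrite -[LHS]trmxK trmx_mul pi_alt theta_alt mulmxN mulNmx opprK theta_pi.
by rewrite trmxB trmx_mul trmxK trmx1.
Qed.

Lemma pair_graphN X xi : gpair (graph (- ii) X 0) xi = contract (covector_of xi) X.
Proof.
rewrite /gpair /covector_of contractZl /= scale0r addr0 contractDl !contractZl.
by rewrite (contract_thetaC X); ring.
Qed.

Lemma cov_graph W z : covector_of (graph ii W z) = ii *: (W *m theta) + (half * z) *: eta.
Proof.
rewrite /covector_of /= addrAC scalerDr -scalerDl !scalerA; congr (_ *: _ + _).
by rewrite mulrDr -mulrDl halfD mul1r.
Qed.

Lemma lift_graph a : lift a = graph ii (ii *: (a *m pi)) (contract a F + contract a F).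
Proof.
apply/pair_equal_spec; split=> //=.
rewrite -scalemxAl scalerA ii2 -mulmxA pi_theta mulmxBr mulmx1 mulmxA contract_mx mul_scalar_mx.
mxring.
Qed.

Lemma covK a : covector_of (lift a) = a.
Proof.
rewrite lift_graph cov_graph -scalemxAl scalerA ii2 -mulmxA pi_theta mulmxBr mulmx1 mulmxA.
rewrite contract_mx mul_scalar_mx mulrDr -mulrDl halfD mul1r; mxring.
Qed.

Lemma contract_eta_lift a : contract eta (lift a).1 = 0.
Proof.
by rewrite /= contractZr contractC contract_mulmxl pi_alt mulmxN eta_pi oppr0 contract0r mulr0.
Qed.

Lemma lift_cov W z : contract eta W = 0 -> lift (covector_of (graph ii W z)) = graph ii W z.
Proof.
move=> eW; rewrite lift_graph cov_graph contractDl !contractZl contract_thetaF etaF.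
rewrite mulmxDl -!scalemxAl eta_pi scaler0 addr0 -mulmxA theta_pi mulmxBr mulmx1 mulmxA.
rewrite contract_mx contractC eW scalerA ii2 mul_scalar_mx scale0r sub0r scaleN1r opprK.
by rewrite mulr0 add0r mulr1 -mulrDl halfD mul1r.
Qed.

(** The Leibniz rule applied to [eta *m pi = 0]. *)
Lemma eta_lieb X : eta *m lie_bivector X pi = - (lie_form X eta *m pi).
Proof.
have := congr1 (fun A => alongm X A) eta_pi; rewrite alongmM// alongm_row.
rewrite [RHS](_ : _ = 0); last by apply/matrixP => i j; rewrite !mxE along0.
move=> /eqP; rewrite addrC addr_eq0 => /eqP e.
by rewrite /lie_bivector !mulmxBr e !mulmxA eta_pi mul0mx subr0 /lie_form mulmxDl opprD.
Qed.

Lemma lieb_alt X : (lie_bivector X pi)^T = - lie_bivector X pi.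
Proof.
rewrite /lie_bivector !trmxB !trmx_mul trmxK -alongm_tr pi_alt alongmN// !(mulNmx, mulmxN); mxring.
Qed.

(** Take the Lie derivative of [theta pi theta = - theta] by the Leibniz rule. On [ker eta] the
    product [theta pi] acts as -1, so the two terms differentiating [theta] become multiples of
    [L_X theta] and the remaining one gives [L_X pi]. *)
Lemma lie2_theta_pi X V W : contract eta V = 0 -> contract eta W = 0 ->
  contract (V *m theta *m lie_bivector X pi) (W *m theta)
    = - contract (V *m lie_two_form X theta) W.
Proof.
move=> eV eW.
have tpt : theta *m pi *m theta = - theta.
  by rewrite theta_pi mulmxBl mul1mx -mulmxA Ftheta mulmx0 sub0r.
have prod : lie_two_form X (theta *m pi *m theta) =
    lie_two_form X theta *m pi *m theta + theta *m lie_bivector X pi *m theta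
      + theta *m pi *m lie_two_form X theta.
  rewrite /lie_two_form /lie_bivector !alongmM// !(mulmxDl, mulmxDr, mulmxBl, mulmxBr, mulNmx,
    mulmxN, mulmxA).
  mxring.
have lN : lie_two_form X (- theta) = - lie_two_form X theta.
  by rewrite /lie_two_form alongmN// mulmxN mulNmx; mxring.
have ker U : contract eta U = 0 -> U *m (theta *m pi) = - U.
  move=> eU; rewrite theta_pi mulmxBr mulmx1 mulmxA contract_mx contractC eU mul_scalar_mx.
  by rewrite scale0r sub0r.
move: prod; rewrite tpt lN; move: (lie_bivector X pi) (lie_two_form X theta) => Q T prod.
have := congr1 (fun A => contract (V *m A) W) prod.
rewrite !mulmxDr !contractDl mulmxN contractNl -[_ *m pi *m theta]mulmxA mulmxA.
rewrite (contract_mulmxl (V *m T)) trmx_mul pi_alt theta_alt mulmxN mulNmx opprK ker//.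
rewrite (mulmxA V (theta *m pi)) ker// mulNmx contractNl contractNr.
rewrite (mulmxA V (theta *m Q)) (mulmxA V theta) (contract_mulmxl (V *m theta *m Q)) theta_alt.
rewrite mulmxN contractNr.
set t := contract _ (W *m theta); set c := contract _ W => e.
have e2 : t + c = - c - (- c - t - c) by ring.
by apply/eqP; rewrite -addr_eq0 e2 -e subrr.
Qed.

Definition dstar_mx (s : gfib K m) xi zeta : K :=
  along xi.1 (gpair s zeta) - along zeta.1 (gpair s xi) - gpair s (courant_mx xi zeta).

(* On sections of [L] the differential of [L^*] is, up to the factor [- i], the Lie derivative
   of [pi], so that the compatibility condition is [lieb_bra]. *)
Lemma dst_lieb a W z W' z' : contract eta W = 0 -> contract eta W' = 0 ->
  dstar_mx (graph (- ii) a 0) (graph ii W z) (graph ii W' z') =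
  - ii * contract (covector_of (graph ii W z) *m lie_bivector a pi) (covector_of (graph ii W' z')).
Proof.
move=> eW eW'.
have aii V : along V ii = 0 by rewrite /along big1// => k _; rewrite dii mulr0.
have ahalf V : along V half = 0 by rewrite /along big1// => k _; rewrite dhalf mulr0.
rewrite /dstar_mx cou_graph//; last by left.
rewrite !pair_graphN !cov_graph /= !mulmxDl -!scalemxAl.
rewrite !(contractDl, contractDr, contractZl, contractZr).
rewrite lie2_theta_pi//.
have ker U : contract eta U = 0 -> U *m theta *m pi = - U.
  move=> eU; rewrite -mulmxA theta_pi mulmxBr mulmx1 mulmxA contract_mx contractC eU.
  by rewrite mul_scalar_mx scale0r sub0r.
(* The [eta]-slots of [L_a pi] are governed by [eta_lieb]: against [V theta] they give
   [(L_a eta)(V)] up to sign, and against [eta] they vanish. *)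
have f1 V : contract eta V = 0 ->
    contract (eta *m lie_bivector a pi) (V *m theta) = - contract (lie_form a eta) V.
  move=> eV; rewrite eta_lieb contractNl contract_mulmxl pi_alt mulmxN contractNr ker//.
  by rewrite contractNr !opprK.
have f2 V : contract eta V = 0 ->
    contract (V *m theta *m lie_bivector a pi) eta = contract (lie_form a eta) V.
  by move=> eV; rewrite contract_mulmxl lieb_alt mulmxN contractNr contractC f1// opprK.
have f3 : contract (eta *m lie_bivector a pi) eta = 0.
  by rewrite eta_lieb contractNl contract_mulmxl pi_alt mulmxN eta_pi oppr0 contract0r oppr0.
have ea V : along V (contract eta a) = contract (lie_form a eta) V by rewrite alongE lie_eta.
rewrite f1// f2// f3 lie2_theta mulmxBr contractBl (contract_mulmxl _ (_^T)) trmxK.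
rewrite -!alongm_row (contractC W).
rewrite !(contract_thetaC _ a) !(alongD, alongM, aii, ahalf, alongN, ea)//.
rewrite !along_contract// !contractNr.
(* The factors [ii] are collected in pairs so that [ii2] applies. *)
have e1 (t h h' : K) :
    - ii * (ii * (ii * - t + half * z' * h) + half * z * (ii * - h' + half * z' * 0))
    = (ii * ii) * (ii * t) - (ii * ii) * (half * z' * h - half * z * h') by ring.
rewrite e1 ii2; ring.
Qed.

Definition wedge_mx (s t : gfib K m) xi zeta : K :=
  gpair s xi * gpair t zeta - gpair s zeta * gpair t xi.

Definition bivector (a b : 'rV[K]_m) : 'M[K]_m := a^T *m b - b^T *m a.

Lemma contract_tensor a b V W : contract (V *m (a^T *m b)) W = contract V a * contract b W.
Proof. by rewrite mulmxA contract_mx mul_scalar_mx contractZl. Qed.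

Lemma contract_biv a b V W :
  contract (V *m bivector a b) W = contract V a * contract b W - contract V b * contract a W.
Proof. by rewrite mulmxBr contractBl !contract_tensor. Qed.

Lemma wdg_graph a b xi zeta : wedge_mx (graph (- ii) a 0) (graph (- ii) b 0) xi zeta =
  contract (covector_of xi *m bivector a b) (covector_of zeta).
Proof. by rewrite /wedge_mx !pair_graphN contract_biv ![contract (covector_of zeta) _]contractC;
  ring. Qed.

Lemma lieb_biv X a b : lie_bivector X (bivector a b)
  = bivector (lie_bracket X a) b + bivector a (lie_bracket X b).
Proof. by rewrite /bivector liebD liebN !lieb_tensor; mxring. Qed.

(** [b = false] is the pair [L], [L^*] and [b = true] the pair [E^(1,0)], [E^(0,1)]. The flag sits
    in opposite slots: restricting the vector parts to [ker eta] on one side is dual to removing the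
    [eta]-coefficient on the other. *)
Variable b : bool.
Local Notation nfA := (normal_form theta eta F (- ii) b true).
Local Notation nfB := (normal_form theta eta F ii true b).

Lemma nfA_graph u : nfA u -> u = graph (- ii) u.1 0.
Proof. by case: u => X a [/= e _ h]; rewrite {1}e h. Qed.

Lemma nfB_graph u : nfB u -> u = graph ii u.1 (contract u.2 F).
Proof. exact: nf_graph. Qed.

Lemma nfB_eta u : nfB u -> contract eta u.1 = 0.
Proof. by case=> _ + _; exact. Qed.

Lemma nfB_lift a : (b -> contract a F = 0) -> nfB (lift a).
Proof.
move=> ab; split=> [|_|/ab aF]; last 1 first.
- by rewrite contractDl contractZl aF mul0r addr0.
- by rewrite {1}lift_graph {2}lift_graph contract_graphF.
- exact: contract_eta_lift.
Qed.

Lemma dnii i : d i (- ii) = 0. Proof. by rewrite derN// dii oppr0. Qed.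

Lemma nfA_cou u v : nfA u -> nfA v -> nfA (courant_mx u v).
Proof. by apply: nf_cou => [i|]; [exact: dnii|exact: orbT]. Qed.

Lemma dst_nf u xi zeta : nfA u -> nfB xi -> nfB zeta ->
  dstar_mx u xi zeta = - ii * contract (covector_of xi *m lie_bivector u.1 pi) (covector_of zeta).
Proof.
move=> nu nx nz; rewrite {1}(nfA_graph nu) {1 2}(nfB_graph nx) {1 2}(nfB_graph nz).
by apply: dst_lieb; exact: nfB_eta.
Qed.

Lemma wdg_nf u v xi zeta : nfA u -> nfA v ->
  wedge_mx u v xi zeta = contract (covector_of xi *m bivector u.1 v.1) (covector_of zeta).
Proof. by move=> nu nv; rewrite {1}(nfA_graph nu) {1}(nfA_graph nv) wdg_graph. Qed.

(* When [b] holds only covectors killing [F] can be tested; this is enough because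
   both sides are then killed by [eta]. *)
Lemma decomposition_unique u r (P : 'I_r -> gfib K m * gfib K m) :
  nfA u -> (forall k, nfA (P k).1 /\ nfA (P k).2) ->
  (forall V W, (b -> contract V F = 0) -> (b -> contract W F = 0) ->
    dstar_mx u (lift V) (lift W) = \sum_k wedge_mx (P k).1 (P k).2 (lift V) (lift W)) ->
  \sum_k bivector (P k).1.1 (P k).2.1 = - ii *: lie_bivector u.1 pi.
Proof.
move=> nu nP dP; set Q := \sum_k _; set Q' := _ *: _.
(* By [covK], testing on lifts amounts to testing on the covectors themselves. *)
have wdgQ V W : \sum_k wedge_mx (P k).1 (P k).2 (lift V) (lift W) = contract (V *m Q) W.
  rewrite contractC mulmx_sumr contract_sumr; apply: eq_bigr => k _.
  by rewrite wdg_nf; [rewrite !covK contractC|exact: (nP k).1|exact: (nP k).2].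
have key V W : (b -> contract V F = 0) -> (b -> contract W F = 0) ->
    contract (V *m Q) W = contract (V *m Q') W.
  move=> bV bW; rewrite -wdgQ -dP// dst_nf; try exact: nfB_lift; last exact: nu.
  by rewrite !covK /Q' -scalemxAr contractZl.
suff QQ V W : contract (V *m Q) W = contract (V *m Q') W.
  apply/row_matrixP => i; rewrite !rowE; apply: contract_ext => W; exact: QQ.
have [bT|bF] := boolP b; last by apply: key => h; rewrite h in bF.
have altQ : Q^T = - Q.
  rewrite /Q -sumrN linear_sum; apply: eq_bigr => k _.
  by rewrite /bivector /= trmxB !trmx_mul !trmxK opprB.
have altQ' : Q'^T = - Q' by rewrite /Q' trmxZ lieb_alt scalerN.
(* For [b] true, [eta] kills [Q] because all vector parts lie in [ker eta], and it kills [Q']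
   because [eta(u.1) = 0] gives [L_u eta = 0]. *)
have etaQ : eta *m Q = 0.
  rewrite /Q mulmx_sumr big1// => k _; have [[_ h1 _] [_ h2 _]] := nP k.
  by rewrite mulmxBr !mulmxA !contract_mx h1// h2// !mul_scalar_mx !scale0r subrr.
have etaQ' : eta *m Q' = 0.
  rewrite /Q' -scalemxAr eta_lieb lie_eta; case: nu => _ -> // _.
  by rewrite grad0// mul0mx oppr0 scaler0.
(* An alternating form killed by [eta] does not change when its arguments are projected along [eta]
   onto the covectors killing [F], which are exactly the available tests. *)
have proj (N : 'M[K]_m) : N^T = - N -> eta *m N = 0 -> forall V W,
    contract (V *m N) W =
    contract ((V - contract V F *: eta) *m N) (W - contract W F *: eta).
  move=> altN eN U U'; rewrite mulmxBl -scalemxAl eN scaler0 subr0 contractBr contractZr.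
  by rewrite [contract _ eta]contract_mulmxl altN mulmxN eN oppr0 contract0r mulr0 subr0.
have pF U : b -> contract (U - contract U F *: eta) F = 0.
  by rewrite contractBl contractZl etaF mulr1 subrr.
by rewrite (proj _ altQ etaQ) (proj _ altQ' etaQ'); apply: key; exact: pF.
Qed.

(** The vector part of a Courant bracket is a Lie bracket, so by [lieb_biv] each Schouten sum is a
    Lie derivative of the bivector of its decomposition. *)
Lemma bialgebroid_identity u v xi zeta r1 r2
    (P1 : 'I_r1 -> gfib K m * gfib K m) (P2 : 'I_r2 -> gfib K m * gfib K m) :
  nfA u -> nfA v -> nfB xi -> nfB zeta ->
  (forall k, nfA (P1 k).1 /\ nfA (P1 k).2) ->
  (forall k, nfA (P2 k).1 /\ nfA (P2 k).2) ->
  \sum_k bivector (P1 k).1.1 (P1 k).2.1 = - ii *: lie_bivector u.1 pi ->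
  \sum_k bivector (P2 k).1.1 (P2 k).2.1 = - ii *: lie_bivector v.1 pi ->
  dstar_mx (courant_mx u v) xi zeta =
    \sum_k (wedge_mx (courant_mx (P1 k).1 v) (P1 k).2 xi zeta
      + wedge_mx (P1 k).1 (courant_mx (P1 k).2 v) xi zeta)
    + \sum_k (wedge_mx (courant_mx u (P2 k).1) (P2 k).2 xi zeta
      + wedge_mx (P2 k).1 (courant_mx u (P2 k).2) xi zeta).
Proof.
move=> nu nv nx nz n1 n2 e1 e2.
rewrite dst_nf//; last exact: nfA_cou.
have s2 : \sum_k (wedge_mx (courant_mx u (P2 k).1) (P2 k).2 xi zeta
  + wedge_mx (P2 k).1 (courant_mx u (P2 k).2) xi zeta)
    = contract (covector_of xi *m lie_bivector u.1 (- ii *: lie_bivector v.1 pi)) (covector_of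
      zeta).
  rewrite -e2 lieb_sum contractC mulmx_sumr contract_sumr; apply: eq_bigr => k _.
  have [h1 h2] := n2 k.
  rewrite !wdg_nf//; try exact: nfA_cou.
  by rewrite -contractDl -mulmxDr lieb_biv contractC.
(* Here the acting section stands on the right of the bracket, whence the minus sign. *)
have s1 : \sum_k (wedge_mx (courant_mx (P1 k).1 v) (P1 k).2 xi zeta
  + wedge_mx (P1 k).1 (courant_mx (P1 k).2 v) xi zeta)
    = - contract (covector_of xi *m lie_bivector v.1 (- ii *: lie_bivector u.1 pi)) (covector_of
      zeta).
  rewrite -e1 lieb_sum contractC mulmx_sumr contract_sumr -sumrN; apply: eq_bigr => k _.
  have [h1 h2] := n1 k.
  rewrite !wdg_nf//; try exact: nfA_cou.
  rewrite -contractDl -mulmxDr lieb_biv [contract (covector_of zeta) _]contractC -contractNl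
    -mulmxN; congr (contract (_ *m _) _).
  rewrite /= !(braN _ v.1) /bivector !(trmxN, mulNmx, mulmxN); mxring.
rewrite s1 s2 !liebZ//; try exact: dnii.
rewrite -!scalemxAr !contractZl /= lieb_bra mulmxBr contractBl; ring.
Qed.

End Bialgebroid.

End CourantAlgebra.

(** * Pointwise linear algebra of a cosymplectic structure *)

Section TopWedge.
Variables (R : realType) (n : nat).
Local Notation m := n.*2.+1.
Variables (eta : 'rV[R]_m) (theta : 'M[R]_m) (X : 'rV[R]_m).
Hypothesis theta_alt : theta^T = - theta.
Hypothesis etaX : contract eta X = 0.
Hypothesis Xtheta : X *m theta = 0.

(** Defined for arbitrary maps, because changing one value of a permutation destroys bijectivity. *)
Let term (f : 'I_m -> 'I_m) : R := eta 0 (f ord0) *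
  \prod_(k < n) theta (f (inord k.*2.+1)) (f (inord k.*2.+2)).
Let upd (f : 'I_m -> 'I_m) p i := fun q => if q == p then i else f q.

Let theta_row j : \sum_i X 0 i * theta i j = 0.
Proof. by have /matrixP/(_ 0 j) := Xtheta; rewrite !mxE. Qed.

Let theta_col j : \sum_i X 0 i * theta j i = 0.
Proof.
have -> : \sum_i X 0 i * theta j i = - \sum_i X 0 i * theta i j.
  rewrite -sumrN; apply: eq_bigr => i _.
  by have /matrixP/(_ i j) := theta_alt; rewrite !mxE => ->; rewrite mulrN.
by rewrite theta_row oppr0.
Qed.

Let val1 (k : 'I_n) : (inord k.*2.+1 : 'I_m) = k.*2.+1 :> nat.
Proof. by rewrite inordK// ltnS ltn_double. Qed.
Let val2 (k : 'I_n) : (inord k.*2.+2 : 'I_m) = k.*2.+2 :> nat.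
Proof. by rewrite inordK// ltnS -doubleS leq_double. Qed.

(** Position 0 occurs only in the factor [eta], any other position in exactly one factor [theta];
    [eta(X) = 0] or [X theta = 0] then applies. *)
Let sum_term_upd f p : \sum_i X 0 i * term (upd f p i) = 0.
Proof.
have neq0 (i j : 'I_m) : (i : nat) <> j -> (i == j) = false.
  by move=> h; apply/negP => /eqP e; apply: h; rewrite e.
have [->|p0] := eqVneq p ord0.
  transitivity ((\sum_i X 0 i * eta 0 i) *
      \prod_(k < n) theta (f (inord k.*2.+1)) (f (inord k.*2.+2))); last first.
    have -> : \sum_i X 0 i * eta 0 i = 0 by rewrite -[RHS]etaX; apply: eq_bigr => i _;
      rewrite mulrC.
    by rewrite mul0r.
  rewrite mulr_suml; apply: eq_bigr => i _; rewrite /term /upd eqxx mulrA; congr (_ * _).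
  by apply: eq_bigr => k _; rewrite !neq0 ?val1 ?val2.
have p0' : (0 < nat_of_ord p)%N by rewrite lt0n; apply: contra_neq p0 => h; exact: val_inj.
(* A position [p > 0] belongs to factor number [(p - 1) / 2], as first index when odd and second
   index when even. *)
have pn : ((nat_of_ord p).-1./2 < n)%N by move: (ltn_ord p) p0'; lia.
pose k := Ordinal pn.
have kE : nat_of_ord k = (nat_of_ord p).-1./2 by [].
have other (l : 'I_n) : l != k ->
    ((inord l.*2.+1 == p) = false) * ((inord l.*2.+2 == p) = false).
  move=> lk; have lk' : nat_of_ord l <> k by move=> h; move/eqP: lk; apply; exact: val_inj.
  by split; apply: neq0; rewrite ?val1 ?val2; move: lk' kE p0'; lia.
have sp : nat_of_ord p = k.*2.+1 \/ nat_of_ord p = k.*2.+2 by move: kE p0'; lia.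
pose c := eta 0 (f ord0) *
  \prod_(l < n | l != k) theta (f (inord l.*2.+1)) (f (inord l.*2.+2)).
have termE i : term (upd f p i) =
    theta (upd f p i (inord k.*2.+1)) (upd f p i (inord k.*2.+2)) * c.
  rewrite /term (bigD1 k)//= /c mulrCA; congr (_ * (_ * _)).
    by rewrite /upd eq_sym (negPf p0).
  by apply: eq_bigr => l lk; rewrite /upd !other.
under eq_bigr do rewrite termE mulrA.
rewrite -mulr_suml [X in X * _](_ : _ = 0) ?mul0r//.
case: sp => sp.
- have e1 : (inord k.*2.+1 == p) by apply/eqP/ord_inj; rewrite val1 sp.
  have e2 : (inord k.*2.+2 == p) = false by apply: neq0; rewrite val2 sp; lia.
  by rewrite -[RHS](theta_row (f (inord k.*2.+2))); apply: eq_bigr => i _; rewrite /upd e1 e2.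
- have e1 : (inord k.*2.+2 == p) by apply/eqP/ord_inj; rewrite val2 sp.
  have e2 : (inord k.*2.+1 == p) = false by apply: neq0; rewrite val1 sp; lia.
  by rewrite -[RHS](theta_col (f (inord k.*2.+1))); apply: eq_bigr => i _; rewrite /upd e1 e2.
Qed.

(** The modified map takes the value [i] at both preimages of [i] and [j], so replacing [s] by
    [s * tperm i j] leaves it unchanged while the sign flips. *)
Let exchange_eq0 i j : i != j ->
  \sum_(s : 'S_m) (-1) ^+ s * term (upd s (s^-1 j)%g i) = 0.
Proof.
move=> ij; set S := \sum_s _.
suff SN : S = - S by lra.
rewrite {1}/S (reindex_inj (mulIg (tperm i j))) -sumrN; apply: eq_bigr => s _.
rewrite odd_permM odd_tperm ij addbT signrN mulNr; congr (- (_ * term _)).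
apply/funext => q; rewrite /upd invMg tpermV !permM tpermR.
rewrite -!(canF_eq (permK s)).
by case: tpermP => [->|->|/eqP/negPf-> /eqP/negPf->]; rewrite ?eqxx ?(negPf ij)// eq_sym (negPf ij).
Qed.

(* [term] is linear in the value at each position, so replacing the value [j] of [s] by the
   components of [X] gives zero; replacing it by [i <> j] yields terms which cancel in pairs. *)
Lemma top_wedge_kernel : top_wedge eta theta != 0 -> X = 0.
Proof.
apply: contra_neqP => /eqP X0; have [j Xj] : exists j, X 0 j != 0.
  apply/existsP; apply: contra_neqT X0 => /existsPn X0; apply/rowP => j.
  by rewrite mxE; apply/eqP; move: (X0 j); rewrite negbK.
apply: (mulfI Xj); rewrite mulr0.
have : \sum_(s : 'S_m) (-1) ^+ s * (\sum_i X 0 i * term (upd s (s^-1 j)%g i)) = 0.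
  by rewrite big1// => s _; rewrite sum_term_upd mulr0.
under eq_bigr do rewrite mulr_sumr.
(* The term [i = j] restores [s] and yields [X 0 j] times [top_wedge]. *)
rewrite exchange_big/= (bigD1 j)//= [X in _ + X]big1 ?addr0 => [<-|i ij].
  rewrite mulr_sumr; apply: eq_bigr => s _; rewrite -mulrA mulrCA; congr (_ * (_ * term _)).
  apply/funext => q; rewrite /upd; case: eqP => [->|//]; exact: permKV.
under eq_bigr do rewrite mulrCA.
by rewrite -mulr_sumr exchange_eq0// mulr0.
Qed.

End TopWedge.

Section AssociatedTensors.
Variables (R : realType) (n : nat).
Local Notation m := n.*2.+1.
Variables (eta F : 'rV[R]_m) (theta pi : 'M[R]_m).
Hypothesis theta_alt : theta^T = - theta.
Hypothesis etaF : contract eta F = 1.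
Hypothesis Ftheta : F *m theta = 0.
Hypothesis vol : top_wedge eta theta != 0.

Let thetaF : theta *m F^T = 0.
Proof. by rewrite -[LHS]trmxK trmx_mul trmxK theta_alt mulmxN Ftheta oppr0 trmx0. Qed.

Let F_flat : F *m flat_mx eta theta = - eta.
Proof. by rewrite mulmxBr Ftheta sub0r mulmxA contract_mx contractC etaF mul1mx. Qed.

Let flat_F : flat_mx eta theta *m F^T = - eta^T.
Proof. by rewrite mulmxBl thetaF sub0r -mulmxA contract_mx etaF mulmx1. Qed.

(** If [flat X = 0], evaluation at [F] gives [eta(X) = 0], hence [X theta = 0], and the volume
    condition forces [X = 0]. *)
Lemma flat_unit : flat_mx eta theta \in unitmx.
Proof.
rewrite -row_free_unit; apply: inj_row_free => X Xflat.
have etaX : contract eta X = 0.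
  have := congr1 (mulmx^~ F^T) Xflat; rewrite /= mul0mx -mulmxA flat_F mulmxN contract_mx.
  move/matrixP/(_ 0 0); rewrite !mxE mulr1n contractC => /eqP.
  by rewrite oppr_eq0 => /eqP.
apply: (top_wedge_kernel theta_alt etaX _ vol).
move: Xflat; rewrite mulmxBr mulmxA contract_mx contractC etaX mul_scalar_mx scale0r.
by rewrite subr0.
Qed.

Hypothesis piE : forall a b : 'rV[R]_m, a *m pi *m b^T
  = (a *m invmx (flat_mx eta theta)) *m theta *m (b *m invmx (flat_mx eta theta))^T.

Let B := invmx (flat_mx eta theta).

Let piB : pi = B *m theta *m B^T.
Proof.
apply/matrixP => i j; have /matrixP/(_ 0 0) := piE (delta_mx 0 i) (delta_mx 0 j).
rewrite trmx_mul !(mulmxA _ B^T) -!contractE !contract_delta.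
by rewrite -(mulmxA _ B) -(mulmxA _ (B *m theta)) -!rowE !mxE.
Qed.

Let etaB : eta *m B = - F.
Proof.
by rewrite -[eta]opprK -F_flat mulNmx -mulmxA mulmxV ?mulmx1// flat_unit.
Qed.

Let B_eta : B *m eta^T = - F^T.
Proof.
by rewrite -[eta^T]opprK -flat_F mulmxN mulmxA mulVmx ?mul1mx// flat_unit.
Qed.

Lemma associated_eta_pi : eta *m pi = 0.
Proof. by rewrite piB !mulmxA etaB mulNmx Ftheta oppr0 mul0mx. Qed.

(** Since [theta] is [flat] plus [eta] tensor [eta], and [flat] maps [F] to [- eta], the product
    [B *m theta] is the projection of covectors along [eta] onto those killing [F]. *)
Lemma associated_theta_pi : theta *m pi = eta^T *m F - 1%:M.
Proof.
have thetaB : B *m theta = 1%:M - F^T *m eta.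
  have -> : theta = flat_mx eta theta + eta^T *m eta by rewrite subrK.
  by rewrite mulmxDr mulVmx ?flat_unit// mulmxA B_eta mulNmx.
have tB : theta *m B^T = eta^T *m F - 1%:M.
  rewrite -[theta]opprK -theta_alt mulNmx -trmx_mul thetaB.
  by rewrite trmxB trmx_mul trmxK trmx1 opprB.
by rewrite piB thetaB mulmxBl mul1mx mulmxBr -mulmxA (mulmxA theta) thetaF mul0mx subr0 tB.
Qed.

End AssociatedTensors.

(** * From smooth functions to the calculus over [sfun D] *)

Section Morphisms.
Variables (K K' : comNzRingType) (f : {rmorphism K -> K'}) (m : nat).

Lemma rmorph_contract (a X : 'rV[K]_m) :
  f (contract a X) = contract (map_mx f a) (map_mx f X).
Proof. by rewrite rmorph_sum; apply: eq_bigr => i _; rewrite rmorphM !mxE. Qed.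

Definition map_gfib (u : gfib K m) : gfib K' m := (map_mx f u.1, map_mx f u.2).

Lemma normal_form_map theta eta F s p q (u : gfib K m) :
  normal_form theta eta F s p q u ->
  normal_form (map_mx f theta) (map_mx f eta) (map_mx f F) (f s) p q (map_gfib u).
Proof.
move=> [e h1 h2]; split=> [|hp|hq] /=; last 2 first.
- by rewrite -rmorph_contract h1// rmorph0.
- by rewrite -rmorph_contract h2// rmorph0.
by rewrite {1}e map_mxD !map_mxZ map_mxM rmorph_contract.
Qed.

End Morphisms.

Section Representation.
Variables (R : realType) (m : nat) (D : domain R m).
Local Notation S := (sfun D).
Local Notation pt := {x | dset D x}.
Local Notation d := (@sder R m D).
Implicit Types (e : 'rV[R]_m -> gfib R[i] m) (u v : gfib S m).

Definition shalf : S := sfun_cst D 2^-1.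

Lemma shalfD : shalf + shalf = 1.
Proof.
rewrite /shalf; apply: sfun_evalP => x; rewrite rmorphD rmorph1 /= sfun_eval_cst.
by rewrite -div1r -splitr.
Qed.

Lemma sder_const z i : d i (sfun_cst D z) = 0.
Proof.
apply: sfun_evalP => x; rewrite rmorph0 sfun_eval_der.
have -> : cpartial i (sfun_cst D z) (sval x) = cpartial i (fun=> z) (sval x).
  by apply: (eq_cpartial (dset_open (d := D))) (svalP x); exact: mk_sfunE.
exact: cpartial_cst.
Qed.

(** A relation rather than an equality: chart components are arbitrary outside the domain, where
    elements of the ring vanish. *)
Definition repf (a : S) (f : 'rV[R]_m -> R[i]) := forall x, sfun_eval x a = f (sval x).
Definition repm p q (A : 'M[S]_(p, q)) (G : 'rV[R]_m -> 'M[R[i]]_(p, q)) :=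
  forall x, map_mx (sfun_eval x) A = G (sval x).
Definition repg u e := forall x, map_gfib (sfun_eval x) u = e (sval x).

Lemma repf_ex f : csmooth_on (dset D) f -> exists a, repf a f.
Proof.
by move=> sf; exists (mk_sfun sf) => x; apply: mk_sfunE; rewrite inE; exact: svalP.
Qed.

Lemma repf_smooth a f : repf a f -> csmooth_on (dset D) f.
Proof.
move=> af; apply: (csmooth_ext (dset_open (d := D))) (sfun_smooth a) => x /set_mem Dx.
exact: (af (exist _ x Dx)).
Qed.

Lemma repm_entry p q (A : 'M[S]_(p, q)) G i j : repm A G -> repf (A i j) (fun x => G x i j).
Proof. by move=> AG x; rewrite -AG mxE. Qed.

Lemma repm_ex p q (G : 'rV[R]_m -> 'M[R[i]]_(p, q)) :
  csmooth_mx_on (dset D) G -> exists A, repm A G.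
Proof.
move=> sG; exists (\matrix_(i, j) mk_sfun (sG i j)) => x.
apply/matrixP => i j; rewrite !mxE.
by apply: mk_sfunE; rewrite inE; exact: svalP.
Qed.

Lemma repm_smooth p q (A : 'M[S]_(p, q)) G : repm A G -> csmooth_mx_on (dset D) G.
Proof. by move=> AG i j; exact: repf_smooth (repm_entry i j AG). Qed.

Lemma repg1 u e : repg u e -> repm u.1 (fun x => (e x).1).
Proof. by move=> ue x; rewrite -ue. Qed.
Lemma repg2 u e : repg u e -> repm u.2 (fun x => (e x).2).
Proof. by move=> ue x; rewrite -ue. Qed.
Lemma repg_pair u e : repm u.1 (fun x => (e x).1) -> repm u.2 (fun x => (e x).2) -> repg u e.
Proof. by move=> h1 h2 x; rewrite /map_gfib h1 h2 -surjective_pairing. Qed.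

Lemma repg_ex e : csmooth_mx_on (dset D) (fun x => (e x).1) ->
  csmooth_mx_on (dset D) (fun x => (e x).2) -> exists u, repg u e.
Proof.
move=> /repm_ex[X hX] /repm_ex[a ha]; exists (X, a); exact: repg_pair.
Qed.

Lemma repm_inj p q (A B : 'M[S]_(p, q)) :
  (forall x, map_mx (sfun_eval x) A = map_mx (sfun_eval x) B) -> A = B.
Proof.
move=> AB; apply/matrixP => i j; apply: sfun_evalP => x.
by have /matrixP/(_ i j) := AB x; rewrite !mxE.
Qed.

Lemma repf_der i a f x : repf a f -> sfun_eval x (d i a) = cpartial i f (sval x).
Proof.
move=> af; rewrite sfun_eval_der.
apply: (eq_cpartial (dset_open (d := D))) (svalP x) => y /set_mem Dy.
exact: (af (exist _ y Dy)).
Qed.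

Lemma repf_along (X : 'rV[S]_m) (V : 'rV[R]_m -> 'rV[R[i]]_m) a f : repm X V -> repf a f ->
  repf (along d X a) (vderiv V f).
Proof.
move=> XV af x; rewrite rmorph_sum; apply: eq_bigr => k _.
by rewrite rmorphM/= (repf_der k x af) -(XV x) mxE.
Qed.

Lemma repf_contract (a X : 'rV[S]_m) (V W : 'rV[R]_m -> 'rV[R[i]]_m) : repm a V -> repm X W ->
  repf (contract a X) (fun x => contract (V x) (W x)).
Proof. by move=> aV XW x; rewrite rmorph_contract aV XW. Qed.

Lemma repf_pair u v e1 e2 : repg u e1 -> repg v e2 ->
  repf (gpair shalf u v) (fun x => pairing (e1 x) (e2 x)).
Proof.
move=> h1 h2 x; rewrite rmorphM rmorphD !rmorph_contract [X in X * _]sfun_eval_cst.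
by rewrite (repg1 h1) (repg2 h1) (repg1 h2) (repg2 h2).
Qed.

Lemma repf_sub a b f g : repf a f -> repf b g -> repf (a - b) (fun x => f x - g x).
Proof. by move=> af bg x; rewrite rmorphB/= af bg. Qed.

Lemma repm_bra (X Y : 'rV[S]_m) (V W : 'rV[R]_m -> 'rV[R[i]]_m) : repm X V -> repm Y W ->
  repm (lie_bracket d X Y) (vbracket V W).
Proof.
move=> XV YW x; apply/rowP => i; rewrite !mxE rmorphB; congr (_ - _).
- have /(_ x) <- := repf_along XV (repm_entry 0 i YW).
  by congr (sfun_eval x _); apply: eq_bigr => k _; rewrite mxE.
- have /(_ x) <- := repf_along YW (repm_entry 0 i XV).
  by congr (sfun_eval x _); apply: eq_bigr => k _; rewrite mxE.
Qed.

Lemma repm_lie (X a : 'rV[S]_m) (V W : 'rV[R]_m -> 'rV[R[i]]_m) : repm X V -> repm a W ->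
  repm (lie_form d X a) (lie1 V W).
Proof.
move=> XV aW x; apply/rowP => i; rewrite !mxE rmorphD; congr (_ + _).
- have /(_ x) <- := repf_along XV (repm_entry 0 i aW).
  by congr (sfun_eval x _); apply: eq_bigr => k _; rewrite mxE.
- rewrite rmorph_sum; apply: eq_bigr => k _.
  by rewrite rmorphM/= !mxE (repf_der i x (repm_entry 0 k XV)) -(aW x) mxE.
Qed.

Lemma repm_grad a f : repf a f -> repm (grad d a) (dfun f).
Proof. by move=> af x; apply/rowP => i; rewrite !mxE (repf_der i x af). Qed.

Lemma repg_cou u v e1 e2 : repg u e1 -> repg v e2 ->
  repg (courant_mx d shalf u v) (courant_loc e1 e2).
Proof.
move=> h1 h2; apply: repg_pair => x /=.
  exact: (repm_bra (repg1 h1) (repg1 h2)).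
rewrite !map_mxB map_mxZ; congr (_ - _ - _).
- exact: (repm_lie (repg1 h1) (repg2 h2)).
- exact: (repm_lie (repg1 h2) (repg2 h1)).
- rewrite [X in X *: _]sfun_eval_cst; congr (_ *: _); apply: repm_grad.
  apply: repf_sub; apply: repf_contract;
    [exact: repg2 h2|exact: repg1 h1|exact: repg2 h1|exact: repg1 h2].
Qed.

Lemma repf_dst u xi zeta e1 e2 e3 : repg u e1 -> repg xi e2 -> repg zeta e3 ->
  repf (dstar_mx d shalf u xi zeta) (d_star e1 e2 e3).
Proof.
move=> h1 h2 h3 x; rewrite !rmorphB; congr (_ - _ - _).
- exact: (repf_along (repg1 h2) (repf_pair h1 h3)).
- exact: (repf_along (repg1 h3) (repf_pair h1 h2)).
- exact: (repf_pair h1 (repg_cou h2 h3)).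
Qed.

Lemma repf_wdg u v xi zeta e1 e2 e3 e4 : repg u e1 -> repg v e2 -> repg xi e3 -> repg zeta e4 ->
  repf (wedge_mx shalf u v xi zeta) (wedge e1 e2 e3 e4).
Proof.
move=> h1 h2 h3 h4 x; rewrite rmorphB; congr (_ - _); rewrite rmorphM; congr (_ * _).
- exact: (repf_pair h1 h3).
- exact: (repf_pair h2 h4).
- exact: (repf_pair h1 h4).
- exact: (repf_pair h2 h3).
Qed.

End Representation.

Section MapGfib.
Variables (K K' : comNzRingType) (f : {rmorphism K -> K'}) (m : nat).
Implicit Types u v : gfib K m.

Lemma map_gfib0 : map_gfib f (0 : gfib K m) = 0.
Proof. by rewrite /map_gfib /= !map_mx0. Qed.
Lemma map_gfibD u v : map_gfib f (u + v) = map_gfib f u + map_gfib f v.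
Proof. by rewrite /map_gfib /= !map_mxD. Qed.
Lemma map_gfibN u : map_gfib f (- u) = - map_gfib f u.
Proof. by rewrite /map_gfib /= !map_mxN. Qed.
Lemma map_gfibZ z u : map_gfib f (z *: u) = f z *: map_gfib f u.
Proof. by rewrite /map_gfib /= !map_mxZ. Qed.

Lemma normal_form_change theta theta' eta eta' F F' s p q u v (A : 'M[K]_m) :
  theta = A *m theta' *m A^T -> eta = eta' *m A^T -> F' = F *m A ->
  v.1 = u.1 *m A -> u.2 = v.2 *m A^T -> (forall a b : 'rV[K]_m, a *m A^T = b *m A^T -> a = b) ->
  normal_form theta eta F s p q u <-> normal_form theta' eta' F' s p q v.
Proof.
move=> tE eE FE v1 u2 Ainj.
have ce : contract eta u.1 = contract eta' v.1 by rewrite eE v1 contract_mulmxl trmxK.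
have cF : contract u.2 F = contract v.2 F' by rewrite FE u2 contract_mulmxl trmxK.
have eq2 : u.2 = s *: (u.1 *m theta) + contract u.2 F *: eta <->
           v.2 = s *: (v.1 *m theta') + contract v.2 F' *: eta'.
  rewrite cF u2 tE eE !mulmxA -v1.
  rewrite scalemxAl [contract _ _ *: (_ *m _)]scalemxAl -mulmxDl; split=> [/Ainj //|e].
  by congr (_ *m _).
split=> -[h1 h2 h3].
- by split; [exact: (eq2.1 h1)|rewrite -ce|rewrite -cF].
- by split; [exact: (eq2.2 h1)|rewrite ce|rewrite cF].
Qed.

(** Reduces the transformation rule for covectors to those for the vector part and the
    [eta]-coefficient, since the graph equation recovers the covector from them. *)
Lemma normal_form_covector theta theta' eta eta' F F' s p q u v (A : 'M[K]_m) :
  theta = A *m theta' *m A^T -> eta = eta' *m A^T -> v.1 = u.1 *m A ->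
  contract v.2 F' = contract u.2 F ->
  normal_form theta eta F s p q u -> normal_form theta' eta' F' s p q v -> u.2 = v.2 *m A^T.
Proof.
move=> tE eE v1 cE [u2 _ _] [v2 _ _]; rewrite {1}u2 {1}v2 cE v1 tE eE.
by rewrite mulmxDl -!scalemxAl !mulmxA.
Qed.

End MapGfib.

(** * The bundles as graphs in a single fibre *)

Section PointwiseBundles.
Variables (R : realType) (m : nat).
Variables (eta F : 'rV[R]_m) (theta pi : 'M[R]_m).
Hypothesis theta_alt : theta^T = - theta.
Hypothesis pi_alt : pi^T = - pi.
Hypothesis etaF : contract eta F = 1.
Hypothesis Ftheta : F *m theta = 0.
Hypothesis eta_pi : eta *m pi = 0.
Hypothesis theta_pi : theta *m pi = eta^T *m F - 1%:M.
Local Notation nf := (normal_form (real_mx theta) (real_mx eta) (real_mx F)).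
Implicit Types (u v : gfib R[i] m) (e : gfib R m).

Lemma real_mxM p q r (A : 'M[R]_(p, q)) (B : 'M[R]_(q,
  r)) : real_mx (A *m B) = real_mx A *m real_mx B.
Proof. exact: map_mxM. Qed.

Lemma real_contract (a X : 'rV[R]_m) :
  contract (real_mx a) (real_mx X) = real_complex R (contract a X).
Proof. by rewrite rmorph_contract. Qed.

Definition re_mx p q (A : 'M[R[i]]_(p, q)) : 'M[R]_(p, q) := map_mx (@complex.Re R) A.
Definition im_mx p q (A : 'M[R[i]]_(p, q)) : 'M[R]_(p, q) := map_mx (@complex.Im R) A.

Lemma complex_mxE p q (A : 'M[R[i]]_(p, q)) : A = real_mx (re_mx A) + 'i%C *: real_mx (im_mx A).
Proof.
apply/matrixP => i j; rewrite !mxE; case: (A i j) => a b /=; simpc.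
by [].
Qed.

Lemma contract_re_im (a : 'rV[R]_m) (X : 'rV[R[i]]_m) : contract (real_mx a) X = 0 ->
  contract a (re_mx X) = 0 /\ contract a (im_mx X) = 0.
Proof.
rewrite {1}[X]complex_mxE contractDr contractZr !real_contract.
move: (contract a (re_mx X)) (contract a (im_mx X)) => p q /eqP.
by simpc; rewrite eq_complex /= => /andP[/eqP-> /eqP->].
Qed.

(** The parameter [e] is real, the graph complex: the real part of the vector is that of [e], and
    its imaginary part encodes the covector of [e], because [pi] inverts [- theta] between [ker eta]
    and [ker F]. The sign [sg] covers both bundles. *)
Lemma E_normal_form (sg : R) (u : gfib R[i] m) : sg * sg = 1 ->
  (exists2 e : gfib R m, contract eta e.1 = 0 /\ contract e.2 F = 0 &
     u = complexify e + (real_complex R sg * 'i%C) *: complexify (e.2 *m pi, e.1 *m theta))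
  <-> nf (real_complex R sg * 'i%C) true true u.
Proof.
move=> sg2; set s := _ * _.
have s2 : s * s = -1.
  by rewrite /s mulrACA -rmorphM sg2 rmorph1 mul1r -expr2 sqr_i.
have piE : pi *m theta = F^T *m eta - 1%:M by exact: (pi_theta theta_alt pi_alt theta_pi).
split=> [[[X a] /= [eX aF] ->]|[/= u2 u1 uF]].
  have aP : (a *m pi) *m theta = - a.
    by rewrite -mulmxA piE mulmxBr mulmx1 mulmxA contract_mx aF mul_scalar_mx scale0r sub0r.
  have cF : contract (real_mx a + s *: real_mx (X *m theta)) (real_mx F) = 0.
    rewrite contractDl contractZl !real_contract aF contract_mulmxl theta_alt mulmxN Ftheta.
    by rewrite oppr0 contract0r rmorph0 mulr0 addr0.
  split=> //= [|_]; last first.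
    rewrite contractDr contractZr !real_contract eX contractC contract_mulmxl pi_alt mulmxN eta_pi.
    by rewrite oppr0 contract0r rmorph0 mulr0 addr0.
  rewrite cF scale0r addr0 mulmxDl -scalemxAl -!real_mxM aP scalerDr scalerA s2.
  by rewrite /real_mx map_mxN scalerN scaleN1r opprK addrC.
have [eA eB] := contract_re_im (u1 isT).
rewrite uF// scale0r addr0 in u2.
set A := re_mx u.1 in eA; set B := im_mx u.1 in eB.
have uE : u.1 = real_mx A + 'i%C *: real_mx B by exact: complex_mxE.
(* The covector [a] of [e] must satisfy [sg a pi = B]; applying [theta] and [pi theta = -1] on
   [ker F] gives this value. *)
exists (A, - sg *: (B *m theta)) => /=.
  split=> //; rewrite contractZl contract_mulmxl theta_alt mulmxN Ftheta oppr0 contract0r mulr0//.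
have Bp : B *m theta *m pi = - B.
  by rewrite -mulmxA theta_pi mulmxBr mulmx1 mulmxA contract_mx contractC eB mul_scalar_mx
    scale0r sub0r.
rewrite [LHS]surjective_pairing u2 uE; apply/pair_equal_spec; split=> /=.
  rewrite -scalemxAl Bp; congr (_ + _).
  rewrite /real_mx map_mxZ map_mxN scalerA scalerN rmorphN mulrN scaleNr opprK; congr (_ *: _).
  by rewrite /s mulrAC -rmorphM sg2 rmorph1 mul1r.
rewrite mulmxDl scalerDr addrC -scalemxAl -!real_mxM scalerA; congr (_ + _).
rewrite [RHS]map_mxZ; congr (_ *: _).
by rewrite /s -mulrA -expr2 sqr_i mulrN1 -rmorphN.
Qed.

(** Because [F *m theta = 0], adding multiples of [F] frees the vector part without affecting the
    covector; the multiple is [eta(u.1)]. *)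
Lemma L_normal_form s u : (exists z v, nf s true true v /\ u = z *: complexify (F, 0) + v)
  <-> nf s false true u.
Proof.
have Ft : real_mx F *m real_mx theta = 0 by rewrite -real_mxM Ftheta /real_mx map_mx0.
have eF : contract (real_mx eta) (real_mx F) = 1 by rewrite real_contract etaF rmorph1.
split=> [[z [v [[v2 v1 vF] ->]]]|[u2 u1 uF]].
  have z0 : z *: real_mx (0 : 'rV[R]_m) = 0 by rewrite /real_mx map_mx0 scaler0.
  split=> //= [|_]; rewrite z0 add0r ?vF// {1}v2 mulmxDl -scalemxAl Ft scaler0 add0r.
  by rewrite vF.
pose z := contract (real_mx eta) u.1.
exists z, (u.1 - z *: real_mx F, u.2); split.
  split=> [|_|_] /=; last exact: uF.
    by rewrite {1}u2 mulmxBl -scalemxAl Ft scaler0 subr0.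
  by rewrite contractBr contractZr eF mulr1 subrr.
rewrite [LHS]surjective_pairing; apply/pair_equal_spec; split=> /=; first by rewrite addrC subrK.
by rewrite /real_mx map_mx0 scaler0 add0r.
Qed.

(** Dually, the multiple of [eta] is read off by evaluating the covector at [F]. *)
Lemma Lstar_normal_form s u : (exists z v, nf s true true v /\ u = z *: complexify (0, eta) + v)
  <-> nf s true false u.
Proof.
have eF : contract (real_mx eta) (real_mx F) = 1 by rewrite real_contract etaF rmorph1.
split=> [[z [v [[v2 v1 vF] ->]]]|[u2 u1 uF]].
  have z0 : z *: real_mx (0 : 'rV[R]_m) = 0 by rewrite /real_mx map_mx0 scaler0.
  split=> [|_|//] /=; rewrite z0 add0r; last exact: v1.
  by rewrite contractDl contractZl eF vF// addr0 mulr1 {1}v2 vF// scale0r addr0 addrC.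
pose z := contract u.2 (real_mx F).
exists z, (u.1, u.2 - z *: real_mx eta); split.
  have cz : contract (u.2 - z *: real_mx eta) (real_mx F) = 0.
    by rewrite contractBl contractZl eF mulr1 subrr.
  split=> [|_|_] /=; [|exact: u1|exact: cz].
  by rewrite cz scale0r addr0 {1}u2 addrK.
rewrite [LHS]surjective_pairing; apply/pair_equal_spec; split=> /=; last by rewrite addrC subrK.
by rewrite /real_mx map_mx0 scaler0 add0r.
Qed.

End PointwiseBundles.

(** * Changes of charts *)

Section ChainRule.
Variables (R : realType) (p m : nat).
Implicit Types (g : 'rV[R]_p -> 'rV[R]_m) (x : 'rV[R]_p).

Lemma rV_differentiable g x :
  (forall j, differentiable (fun y => g y 0 j) x) -> differentiable g x.
Proof.
move=> dg.
have -> : g = \sum_j (fun y => g y 0 j *: (delta_mx 0 j : 'rV[R]_m)).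
  apply/funext => y; rewrite fct_sumE [LHS]row_sum_delta.
  by [].
by apply: differentiable_sum => j; exact: differentiableZl.
Qed.

Lemma jacobian_entry g x i j : differentiable g x ->
  jacobian g x i j = partial i (fun y => g y 0 j) x.
Proof.
move=> dg; rewrite /jacobian mxE -deriveE// derive_mx ?mxE//.
exact: diff_derivable.
Qed.

Lemma partial_comp g (f : 'rV[R]_m -> R) x i :
  differentiable g x -> differentiable f (g x) ->
  partial i (fun y => f (g y)) x = \sum_k jacobian g x i k * partial k f (g x).
Proof.
move=> dg df; rewrite /partial deriveE; last exact: differentiable_comp.
rewrite diff_comp//= -mul_rV_lin1 -/(jacobian g x) -rowE [row i _]row_sum_delta.
rewrite linear_sum; apply: eq_bigr => k _.
by rewrite linearZ/= mxE -deriveE.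
Qed.

End ChainRule.

Section Overlap.
Variables (R : realType) (m : nat) (M : manifold R m) (c d : chart M).
Local Notation tau := (transition c d).

Lemma overlap_cod x : overlap c d x -> chart_cod c x.
Proof. by case. Qed.

Lemma transition_cod x : overlap c d x -> chart_cod d (tau x).
Proof. by case=> _; exact: chart_map_cod. Qed.

Lemma overlap_open : open (overlap c d).
Proof.
rewrite openE => x [cx dx].
have ct : {for x, continuous (chart_inv c)}.
  have := @chart_inv_continuous _ _ _ c.
  by rewrite continuous_open_subspace; [apply; rewrite inE|exact: open_chart_cod].
have n1 : nbhs x (chart_cod c) by apply: open_nbhs_nbhs; split=> //; exact: open_chart_cod.
have n2 : nbhs x (chart_inv c @^-1` chart_dom d).
  by apply: ct; apply: open_nbhs_nbhs; split=> //; exact: open_chart_dom.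
exact: filterI n1 n2.
Qed.

Lemma transition_differentiable x : overlap c d x -> differentiable tau x.
Proof.
move=> ox; apply: rV_differentiable => j.
exact: (smooth_differentiable (@chart_smooth _ _ M c d 0 j) ox).
Qed.

Lemma cpartial_transition (f : 'rV[R]_m -> R[i]) x i : overlap c d x ->
  csmooth_on (chart_cod d) f ->
  cpartial i (fun y => f (tau y)) x =
  \sum_k real_complex R (jac c d x i k) * cpartial k f (tau x).
Proof.
move=> ox [fr fi]; have dx := transition_cod ox; have dt := transition_differentiable ox.
have -> : \sum_k real_complex R (jac c d x i k) * cpartial k f (tau x) =
  ((\sum_k jac c d x i k * partial k (fun y => complex.Re (f y)) (tau x)) +i*
   (\sum_k jac c d x i k * partial k (fun y => complex.Im (f y)) (tau x)))%C.
  apply: (big_rec3 (fun a b z => z = (a +i* b)%C)) => // k a b z _ ->.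
  by rewrite /cpartial; simpc.
exact: (f_equal2 (@Complex R) (partial_comp i dt (smooth_differentiable fr dx))
                              (partial_comp i dt (smooth_differentiable fi dx))).
Qed.

Lemma jacE x i j : overlap c d x -> jac c d x i j = partial i (fun y => tau y 0 j) x.
Proof. by move=> ox; apply/jacobian_entry/transition_differentiable. Qed.

End Overlap.

Section Restriction.
Variables (R : realType) (m : nat) (U V : set 'rV[R]_m).
Hypothesis UV : U `<=` V.

Lemma csmooth_sub (f : 'rV[R]_m -> R[i]) : csmooth_on V f -> csmooth_on U f.
Proof. by move=> [fr fi]; split=> s x /UV; [exact: fr|exact: fi]. Qed.

Lemma csmooth_mx_sub p q (A : 'rV[R]_m -> 'M[R[i]]_(p, q)) :
  csmooth_mx_on V A -> csmooth_mx_on U A.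
Proof. by move=> sA i j; exact: csmooth_sub. Qed.

End Restriction.

Section TransitionBracket.
Variables (R : realType) (m : nat) (M : manifold R m) (c d : chart M).
Local Notation tau := (transition c d).
Implicit Types (Vc Vd Wc Wd : 'rV[R]_m -> 'rV[R[i]]_m).

Lemma vderiv_transition Vc Vd (fc fd : 'rV[R]_m -> R[i]) x : overlap c d x ->
  csmooth_on (chart_cod d) fd -> Vd (tau x) = Vc x *m real_mx (jac c d x) ->
  {in overlap c d, forall y, fd (tau y) = fc y} ->
  vderiv Vd fd (tau x) = vderiv Vc fc x.
Proof.
move=> ox sf Vx ff; rewrite /vderiv.
under [RHS]eq_bigr => j _.
  rewrite -(eq_cpartial (@overlap_open _ _ M c d) j ff ox) (cpartial_transition _ ox sf).
  rewrite mulr_sumr; over.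
rewrite exchange_big; apply: eq_bigr => k _; rewrite Vx mxE mulr_suml.
by apply: eq_bigr => j _; rewrite mxE mulrA.
Qed.

(** The chain rule moves the derivatives of the second chart to the first, where the claim is
    [bra_curlfree] over the ring of functions on the overlap. *)
Lemma vbracket_transition Vc Vd Wc Wd x : overlap c d x ->
  csmooth_mx_on (chart_cod c) Vc -> csmooth_mx_on (chart_cod c) Wc ->
  csmooth_mx_on (chart_cod d) Vd -> csmooth_mx_on (chart_cod d) Wd ->
  (forall y, overlap c d y -> Vd (tau y) = Vc y *m real_mx (jac c d y)) ->
  (forall y, overlap c d y -> Wd (tau y) = Wc y *m real_mx (jac c d y)) ->
  vbracket Vd Wd (tau x) = vbracket Vc Wc x *m real_mx (jac c d x).
Proof.
move=> ox sVc sWc sVd sWd hV hW.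
pose D := Domain (@overlap_open _ _ M c d) ox.
pose x0 : {x | dset D x} := exist _ x ox.
have subD : dset D `<=` chart_cod c by move=> y /overlap_cod.
have [X rX] := @repm_ex _ _ D _ _ _ (csmooth_mx_sub subD sVc).
have [Y rY] := @repm_ex _ _ D _ _ _ (csmooth_mx_sub subD sWc).
have [T rT] : exists T : 'rV[sfun D]_m, repm T (fun y => real_mx (tau y)).
  apply: repm_ex => i j.
  have := csmooth_real (@overlap_open _ _ M c d) (@chart_smooth _ _ M c d i j).
  by apply: csmooth_ext => [|y _]; [exact: overlap_open|rewrite mxE].
have rJ : repm (jacm (@sder _ _ D) T) (fun y => real_mx (jac c d y)).
  move=> y; apply/matrixP => i j;
    rewrite [LHS]mxE [jacm _ _ _ _]mxE [RHS]mxE (repf_der i y (repm_entry 0 j rT)).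
  rewrite jacE; last exact: svalP.
  rewrite -cpartial_real; congr (cpartial i _ _).
  by apply/funext => z; rewrite mxE.
(* Symmetry of the second derivatives of the transition map is the curl-freeness of its Jacobian. *)
have sym i j k : sder i (jacm (@sder _ _ D) T k j) = sder k (jacm (@sder _ _ D) T i j).
  by rewrite !mxE sderC.
move: (jacm _ T) sym rJ => J sym rJ.
have rXJ : repm (X *m J) (fun y => Vc y *m real_mx (jac c d y)).
  by move=> y; rewrite map_mxM rX rJ.
have rYJ : repm (Y *m J) (fun y => Wc y *m real_mx (jac c d y)).
  by move=> y; rewrite map_mxM rY rJ.
rewrite -[vbracket Vc Wc x](repm_bra rX rY x0) -[real_mx _](rJ x0) -map_mxM.
rewrite -bra_curlfree//; try exact: sderD; try exact: sderM.
apply/rowP => i; rewrite !mxE rmorphB /=; congr (_ - _).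
- have := @vderiv_transition Vc Vd (fun y => (Wc y *m real_mx (jac c d y)) 0 i)
    (fun y => Wd y 0 i) x ox (sWd 0 i) (hV x ox).
  move=> ->; last by move=> y /set_mem oy; rewrite hW.
  rewrite -[LHS](repf_along rX (repm_entry 0 i rYJ) x0).
  by congr (sfun_eval x0 _); apply: eq_bigr => k _; rewrite [jacm _ _ _ _]mxE.
- have := @vderiv_transition Wc Wd (fun y => (Vc y *m real_mx (jac c d y)) 0 i)
    (fun y => Vd y 0 i) x ox (sVd 0 i) (hW x ox).
  move=> ->; last by move=> y /set_mem oy; rewrite hV.
  rewrite -[LHS](repf_along rY (repm_entry 0 i rXJ) x0).
  by congr (sfun_eval x0 _); apply: eq_bigr => k _; rewrite [jacm _ _ _ _]mxE.
Qed.

End TransitionBracket.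

(** * The bundles of a cosymplectic structure *)

Section CosymplecticBundles.
Variables (R : realType) (n : nat) (M : manifold R n.*2.+1).
Local Notation m := n.*2.+1.
Variables (eta : mfield M 'rV[R]_m) (theta : mfield M 'M[R]_m).
Hypothesis cosymp : cosymplectic eta theta.
Variable J : gac_structure M.
Hypothesis assocJ : associated eta theta J.
Implicit Types (c : chart M) (s : R[i]) (p q : bool) (A : gbundle M).

Section Pointwise.
Variables (c : chart M) (x : 'rV[R]_m).
Hypothesis cx : chart_cod c x.

Lemma theta_altx : (theta c x)^T = - theta c x.
Proof. by case: cosymp => _ [[_ h _] _] _; exact: h. Qed.
Lemma pi_altx : (gpi J c x)^T = - gpi J c x.
Proof. by case: assocJ => _ [_ h _] _; exact: h. Qed.
Lemma etaFx : contract (eta c x) (gF J c x) = 1.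
Proof. by case: assocJ => _ _ /(_ c x cx)[_ _ _ [h _] _]. Qed.
Lemma Fthetax : gF J c x *m theta c x = 0.
Proof. by case: assocJ => _ _ /(_ c x cx)[_ _ _ [_ h] _]. Qed.
Lemma volx : top_wedge (eta c x) (theta c x) != 0.
Proof. by case: cosymp => _ _; exact. Qed.
Lemma flat_unitx : flat_mx (eta c x) (theta c x) \in unitmx.
Proof. exact: flat_unit theta_altx etaFx Fthetax volx. Qed.
Lemma eta_pix : eta c x *m gpi J c x = 0.
Proof.
case: assocJ => _ _ /(_ c x cx)[_ _ _ _ h].
exact: associated_eta_pi theta_altx etaFx Fthetax volx h.
Qed.
Lemma theta_pix : theta c x *m gpi J c x = (eta c x)^T *m gF J c x - 1%:M.
Proof.
case: assocJ => _ _ /(_ c x cx)[_ _ _ _ h].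
exact: associated_theta_pi theta_altx etaFx Fthetax volx h.
Qed.

End Pointwise.

Definition nf_bundle s p q : gbundle M := fun c x =>
  [set u | normal_form (real_mx (theta c x)) (real_mx (eta c x)) (real_mx (gF J c x)) s p q u].

Lemma E10_nf c x u : chart_cod c x -> E10 J c x u <-> nf_bundle (- 'i%C) true true c x u.
Proof.
move=> cx; have := E_normal_form (theta_altx cx) (pi_altx cx) (Fthetax cx) (eta_pix cx)
  (theta_pix cx) u (_ : (-1) * (-1) = 1 :> R); rewrite mulrNN mulr1 => /(_ erefl).
rewrite rmorphN rmorph1 mulN1r => h; apply: iff_trans h.
have [_ _ /(_ c x cx)[eE tE phE _ _]] := assocJ.
have PhiE e : gPhi J c x e = (e.2 *m gpi J c x, e.1 *m theta c x).
  by rewrite /gPhi tE phE trmx0 !mulmx0 add0r subr0.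
by split=> -[e ke ->]; exists e; rewrite ?PhiE ?scaleNr//; move: ke; rewrite /ker_sum /= eE.
Qed.

Lemma E01_nf c x u : chart_cod c x -> E01 J c x u <-> nf_bundle 'i%C true true c x u.
Proof.
move=> cx; have := E_normal_form (theta_altx cx) (pi_altx cx) (Fthetax cx) (eta_pix cx)
  (theta_pix cx) u (mulr1 (1 : R)).
rewrite rmorph1 mul1r => h; apply: iff_trans h.
have [_ _ /(_ c x cx)[eE tE phE _ _]] := assocJ.
have PhiE e : gPhi J c x e = (e.2 *m gpi J c x, e.1 *m theta c x).
  by rewrite /gPhi tE phE trmx0 !mulmx0 add0r subr0.
by split=> -[e ke ->]; exists e; rewrite ?PhiE//; move: ke; rewrite /ker_sum /= eE.
Qed.

Lemma L_nf c x u : chart_cod c x -> bundle_L J c x u <-> nf_bundle (- 'i%C) false true c x u.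
Proof.
move=> cx; apply: iff_trans (L_normal_form (etaFx cx) (Fthetax cx) _ _).
split=> [[_ [z ->] [v Ev <-]]|[z [v [Ev ->]]]].
- by exists z, v; split=> //; exact: (E10_nf _ cx).1 Ev.
- by exists (z *: complexify (gF J c x, 0)); [exists z|exists v => //; exact: (E10_nf _ cx).2 Ev].
Qed.

Lemma Lstar_nf c x u : chart_cod c x -> bundle_Lstar J c x u <-> nf_bundle 'i%C true false c x u.
Proof.
move=> cx; apply: iff_trans (Lstar_normal_form _ (etaFx cx) _ _).
have [_ _ /(_ c x cx)[eE _ _ _ _]] := assocJ.
split=> [[_ [z ->] [v Ev <-]]|[z [v [Ev ->]]]].
- by exists z, v; rewrite eE; split=> //; exact: (E01_nf _ cx).1 Ev.
- by exists (z *: complexify (0, geta J c x)); [exists z|exists v;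
  [exact: (E01_nf _ cx).2 Ev|rewrite eE]].
Qed.

Section OverDomain.
Variables (c : chart M) (D : domain R m).
Hypothesis sub : dset D `<=` chart_cod c.
Local Notation S := (sfun D).
Local Notation d := (@sder R m D).

Let real_rep k l (N : 'rV[R]_m -> 'M[R]_(k, l)) : smooth_mx_on (chart_cod c) N ->
  exists N' : 'M[S]_(k, l), repm N' (fun x => real_mx (N x)).
Proof.
move=> sN; apply: repm_ex; apply: (csmooth_mx_sub sub) => i j.
apply: (csmooth_ext (@open_chart_cod _ _ M c)) (csmooth_real (@open_chart_cod _ _ M c) (sN i j)).
by move=> x _; rewrite mxE.
Qed.

Lemma fields_rep : exists (th : 'M[S]_m) (et F : 'rV[S]_m) (pi : 'M[S]_m),
  [/\ repm th (fun x => real_mx (theta c x)), repm et (fun x => real_mx (eta c x)),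
      repm F (fun x => real_mx (gF J c x)) & repm pi (fun x => real_mx (gpi J c x))].
Proof.
have [[[e1 _] _] [[t1 _ _] _] _] := cosymp; have [[f1 _] [p1 _ _] _] := assocJ.
have [th ?] := real_rep (t1 c); have [et ?] := real_rep (e1 c).
have [F ?] := real_rep (f1 c); have [pi ?] := real_rep (p1 c).
by exists th, et, F, pi.
Qed.

Variables (th : 'M[S]_m) (et F : 'rV[S]_m) (pi : 'M[S]_m).
Hypothesis rth : repm th (fun x => real_mx (theta c x)).
Hypothesis ret : repm et (fun x => real_mx (eta c x)).
Hypothesis rF : repm F (fun x => real_mx (gF J c x)).
Hypothesis rpi : repm pi (fun x => real_mx (gpi J c x)).

Let cD (x : {x | dset D x}) : chart_cod c (sval x). Proof. exact: sub (svalP x). Qed.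

Lemma et_closed i j : d i (et 0 j) = d j (et 0 i).
Proof.
apply: sfun_evalP => x; rewrite (repf_der i x (repm_entry 0 j ret)) (repf_der j x (repm_entry 0 i
  ret)).
have [[_ /(_ c (sval x) (cD x) i j)/subr0_eq e] _ _] := cosymp.
have e' k l : cpartial k (fun y => real_mx (eta c y) 0 l) (sval x) =
    real_complex R (partial k (fun y => eta c y 0 l) (sval x)).
  by rewrite -cpartial_real; congr (cpartial k _ _); apply/funext => y; rewrite mxE.
by rewrite !e' e.
Qed.

Lemma th_closed i j k : d i (th j k) + d j (th k i) + d k (th i j) = 0.
Proof.
apply: sfun_evalP => x; rewrite !rmorphD rmorph0 /=.
rewrite (repf_der i x (repm_entry j k rth)) (repf_der j x (repm_entry k i rth)).
rewrite (repf_der k x (repm_entry i j rth)).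
have [_ [_ /(_ c (sval x) (cD x) i j k) e] _] := cosymp.
have e' a k' l : cpartial a (fun y => real_mx (theta c y) k' l) (sval x) =
    real_complex R (partial a (fun y => theta c y k' l) (sval x)).
  by rewrite -cpartial_real; congr (cpartial a _ _); apply/funext => y; rewrite mxE.
by rewrite !e' -!rmorphD e rmorph0.
Qed.

Lemma th_alt : th^T = - th.
Proof.
apply: repm_inj => x; rewrite -map_trmx map_mxN rth /real_mx map_trmx -map_mxN.
by rewrite theta_altx//; exact: cD.
Qed.

Lemma pi_alt_rep : pi^T = - pi.
Proof.
apply: repm_inj => x; rewrite -map_trmx map_mxN rpi /real_mx map_trmx -map_mxN.
by rewrite pi_altx//; exact: cD.
Qed.

Lemma et_F : contract et F = 1.
Proof.
apply: sfun_evalP => x; rewrite (repf_contract ret rF) rmorph1 real_contract etaFx ?rmorph1//.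
Qed.

Lemma F_th : F *m th = 0.
Proof.
apply: repm_inj => x; rewrite map_mxM rF rth -real_mxM Fthetax ?map_mx0; last exact: cD.
by rewrite /real_mx map_mx0.
Qed.

Lemma et_pi : et *m pi = 0.
Proof.
apply: repm_inj => x; rewrite map_mxM ret rpi -real_mxM eta_pix ?map_mx0; last exact: cD.
by rewrite /real_mx map_mx0.
Qed.

Lemma th_pi : th *m pi = et^T *m F - 1%:M.
Proof.
apply: repm_inj => x; rewrite map_mxB !map_mxM -map_trmx map_mx1 ret rpi rF rth -real_mxM.
rewrite theta_pix; last exact: cD.
by rewrite /real_mx map_mxB map_mxM map_trmx map_mx1.
Qed.

Definition nf_D s p q : gfib S m -> Prop := normal_form th et F (sfun_cst D s) p q.

Lemma nf_D_eval s p q u e : repg u e ->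
  nf_D s p q u <-> forall x, dset D x -> nf_bundle s p q c x (e x).
Proof.
move=> ue; split=> [nu x Dx|ne].
  have := normal_form_map (sfun_eval (exist _ x Dx)) nu.
  by rewrite rth ret rF ue [X in normal_form _ _ _ X]sfun_eval_cst.
have ne' (x : {x | dset D x}) := ne _ (svalP x).
have cE (x : {x | dset D x}) : sfun_eval x (contract u.2 F) =
    contract (e (sval x)).2 (real_mx (gF J c (sval x))).
  exact: (repf_contract (repg2 ue) rF x).
split=> [|hp|hq].
- apply: repm_inj => x; have [h _ _] := ne' x.
  rewrite map_mxD !map_mxZ map_mxM (repg1 ue) (repg2 ue) rth ret.
  by rewrite [X in X *: (_ *m _)]sfun_eval_cst [X in _ + X *: _]cE.
- apply: sfun_evalP => x; rewrite (repf_contract ret (repg1 ue) x) rmorph0.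
  by have [_ h _] := ne' x; exact: h.
- by apply: sfun_evalP => x; rewrite cE rmorph0; have [_ _ h] := ne' x; exact: h.
Qed.

Lemma local_section_rep A s p q e :
  (forall x u, chart_cod c x -> A c x u <-> nf_bundle s p q c x u) ->
  local_section A c (dset D) e -> exists u, repg u e /\ nf_D s p q u.
Proof.
move=> hA [s1 s2 sA]; have [u ue] := repg_ex s1 s2; exists u; split=> //.
by apply/(nf_D_eval _ _ _ ue) => x Dx; apply/(hA _ _ (sub Dx)); exact: sA.
Qed.

Lemma rep_local_section A s p q u e :
  (forall x u, chart_cod c x -> A c x u <-> nf_bundle s p q c x u) ->
  repg u e -> nf_D s p q u -> local_section A c (dset D) e.
Proof.
move=> hA ue nu; split; [exact: repm_smooth (repg1 ue)|exact: repm_smooth (repg2 ue)|].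
by move=> x Dx; apply/(hA _ _ (sub Dx)); exact: (nf_D_eval _ _ _ ue).1 nu x Dx.
Qed.

Lemma nf_D_cou s p q u v : p || q -> nf_D s p q u -> nf_D s p q v ->
  nf_D s p q (courant_mx d (shalf D) u v) /\
  contract (courant_mx d (shalf D) u v).2 F
    = along d u.1 (contract v.2 F) - along d v.1 (contract u.2 F).
Proof.
move=> pq nu nv; split.
  exact: (nf_cou (@sderD _ _ D) (@sderM _ _ D) (shalfD D) et_closed th_alt th_closed et_F F_th
    (sder_const D s) pq nu nv).
rewrite (nf_cou_graph (@sderD _ _ D) (@sderM _ _ D) (shalfD D) et_closed th_alt th_closed
  (sder_const D s) pq nu nv).
by rewrite (contract_graphF th_alt et_F F_th).
Qed.

Lemma nf_D_jacobi s p q u v w : p || q -> nf_D s p q u -> nf_D s p q v -> nf_D s p q w ->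
  courant_mx d (shalf D) u (courant_mx d (shalf D) v w)
    + courant_mx d (shalf D) v (courant_mx d (shalf D) w u)
  + courant_mx d (shalf D) w (courant_mx d (shalf D) u v) = 0.
Proof.
move=> pq nu nv nw.
exact: (nf_jacobi (@sderD _ _ D) (@sderM _ _ D) (@sderC _ _ D) (shalfD D) et_closed th_alt
  th_closed et_F F_th (sder_const D s) pq nu nv nw).
Qed.

Lemma nf_D_leibniz s p q u v g : p || q -> nf_D s p q u -> nf_D s p q v ->
  courant_mx d (shalf D) u (g *: v) = g *: courant_mx d (shalf D) u v + along d u.1 g *: v.
Proof.
move=> pq nu nv; rewrite (cou_leibniz (@sderM _ _ D) (shalfD D)).
by rewrite (nf_isotropic _ th_alt et_F F_th pq nu nv) scale0r subr0.
Qed.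

End OverDomain.

Section ChartChange.
Variables (c d : chart M) (x : 'rV[R]_m).
Hypothesis ox : overlap c d x.
Local Notation tau := (transition c d).
Local Notation Jx := (jac c d x).

Let theta_change : theta c x = Jx *m theta d (tau x) *m Jx^T.
Proof. by case: cosymp => _ [[_ _ h] _] _; exact: h. Qed.
Let eta_change : eta c x = eta d (tau x) *m Jx^T.
Proof. by case: cosymp => [[[_ h] _]] _ _; exact: h. Qed.

Lemma F_change : gF J d (tau x) = gF J c x *m Jx.
Proof. by case: assocJ => [[_ h]] _ _; exact: h. Qed.

(** No inverse transition is needed: the matrix of [flat] in the first chart factors through the
    Jacobian and its transpose, and it is invertible. *)
Lemma jac_unit : Jx \in unitmx.
Proof.
have := flat_unitx (overlap_cod ox).
rewrite (_ : flat_mx _ _ = Jx *m flat_mx (eta d (tau x)) (theta d (tau x)) *m Jx^T).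
  by rewrite !unitmx_mul => /andP[/andP[]].
rewrite /flat_mx mulmxBr mulmxBl -theta_change eta_change.
by rewrite trmx_mul trmxK !mulmxA.
Qed.

Lemma jac_tr_inj (a b : 'rV[R[i]]_m) :
  a *m (real_mx Jx)^T = b *m (real_mx Jx)^T -> a = b.
Proof.
apply: (can_inj (mulmxK _)); rewrite unitmx_tr map_unitmx; exact: jac_unit.
Qed.

Lemma real_theta_change : real_mx (theta c x) =
  real_mx Jx *m real_mx (theta d (tau x)) *m (real_mx Jx)^T.
Proof. by rewrite theta_change /real_mx !map_mxM map_trmx. Qed.

Lemma real_eta_change : real_mx (eta c x) = real_mx (eta d (tau x)) *m (real_mx Jx)^T.
Proof. by rewrite eta_change /real_mx map_mxM map_trmx. Qed.

Lemma nfb_change s p q u v : gtransforms c d x u v ->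
  nf_bundle s p q c x u <-> nf_bundle s p q d (tau x) v.
Proof.
move=> [v1 u2]; apply: (normal_form_change _ _ _ real_theta_change real_eta_change _ v1 u2
  jac_tr_inj).
by rewrite F_change /real_mx map_mxM.
Qed.

End ChartChange.

(** * Closure under the bracket and the Lie algebroid axioms *)

Section BracketsOfSections.
Variables (A : gbundle M) (s : R[i]) (p q : bool).
Hypothesis hA : forall c x u, chart_cod c x -> A c x u <-> nf_bundle s p q c x u.
Hypothesis pq : p || q.
Implicit Types (a b e : mfield M (gfib R[i] m)).

Lemma gsections_local a c U : U `<=` chart_cod c -> gsections A a -> local_section A c U (a c).
Proof.
move=> UC [[s1 s2 _] sA]; split=> [||x /UC]; last exact: sA.
- exact: (csmooth_mx_sub UC (s1 c)).
- exact: (csmooth_mx_sub UC (s2 c)).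
Qed.

Definition cod_domain c x (cx : chart_cod c x) : domain R m := Domain (@open_chart_cod _ _ M c) cx.

Let scalar (e : mfield M (gfib R[i] m)) c y := contract (e c y).2 (real_mx (gF J c y)).

Lemma courant_section_local a b c x : chart_cod c x -> gsections A a -> gsections A b ->
  [/\ csmooth_mx_on (chart_cod c) (fun x => (courant a b c x).1),
      csmooth_mx_on (chart_cod c) (fun x => (courant a b c x).2),
      A c x (courant a b c x) &
      scalar (courant a b) c x =
      vderiv (fun y => (a c y).1) (scalar b c) x - vderiv (fun y => (b c y).1) (scalar a c) x].
Proof.
move=> cx ga gb; pose D := cod_domain cx; pose x0 : {x | dset D x} := exist _ x cx.
have sub : dset D `<=` chart_cod c by [].
have [th [et [F [pi [rth ret rF rpi]]]]] := fields_rep sub.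
have hAc y u : chart_cod c y -> A c y u <-> nf_bundle s p q c y u by exact: hA.
have [u [ru nu]] := local_section_rep sub rth ret rF hAc (gsections_local sub ga).
have [v [rv nv]] := local_section_rep sub rth ret rF hAc (gsections_local sub gb).
have [nuv cF] := nf_D_cou sub rth ret rF pq nu nv.
have ruv := repg_cou ru rv.
have [h1 h2 h3] := rep_local_section sub rth ret rF hAc ruv nuv.
split=> //; first exact: h3.
have ra := repf_contract (repg2 ru) rF; have rb := repf_contract (repg2 rv) rF.
rewrite -[LHS](repf_contract (repg2 ruv) rF x0) cF rmorphB /=; congr (_ - _).
- exact: (repf_along (repg1 ru) rb x0).
- exact: (repf_along (repg1 rv) ra x0).
Qed.

(** The vector part transforms by naturality of the Lie bracket and the [eta]-coefficient is a
    scalar, so [normal_form_covector] applies. *)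
Lemma courant_transforms a b c d x : overlap c d x -> gsections A a -> gsections A b ->
  gtransforms c d x (courant a b c x) (courant a b d (transition c d x)).
Proof.
move=> ox ga gb; have cx := overlap_cod ox; have dx := transition_cod ox.
have [_ _ Au zu] := courant_section_local cx ga gb.
have [_ _ Av zv] := courant_section_local dx ga gb.
have [[sa1 sa2 ta] _] := ga; have [[sb1 sb2 tb] _] := gb.
have v1 : (courant a b d (transition c d x)).1 = (courant a b c x).1 *m real_mx (jac c d x).
  by apply: vbracket_transition => // y oy; [case: (ta c d y oy)|case: (tb c d y oy)].
split=> //.
have scal e (ge : gsections A e) y : overlap c d y ->
    scalar e d (transition c d y) = scalar e c y.
  move=> oy; have [[_ _ te] _] := ge; have [_ e2] := te c d y oy.
  by rewrite /scalar e2 F_change// /real_mx map_mxM contract_mulmxl trmxK.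
(* The chain rule requires smoothness on the whole target chart, not merely on the overlap. *)
have sscal e (ge : gsections A e) : csmooth_on (chart_cod d) (scalar e d).
  move=> {a b ga gb Au zu Av zv sa1 sa2 ta sb1 sb2 tb v1 scal}.
  pose D := cod_domain dx.
  have sub : dset D `<=` chart_cod d by [].
  have [th [et [F [pi [rth ret rF rpi]]]]] := fields_rep sub.
  have hAd y u : chart_cod d y -> A d y u <-> nf_bundle s p q d y u by exact: hA.
  have [u [ru nu]] := local_section_rep sub rth ret rF hAd (gsections_local sub ge).
  exact: repf_smooth (repf_contract (repg2 ru) rF).
have dv e e' : gsections A e -> gsections A e' ->
    vderiv (fun y => (e d y).1) (scalar e' d) (transition c d x) =
    vderiv (fun y => (e c y).1) (scalar e' c) x.
  move=> [[_ _ te] _] ge'.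
  apply: (vderiv_transition ox (sscal _ ge')) => [|y /set_mem oy]; last exact: scal.
  by case: (te c d x ox).
have zE : scalar (courant a b) d (transition c d x) = scalar (courant a b) c x.
  apply: etrans zv _; apply: etrans (esym zu).
  exact: (f_equal2 (fun z w => z - w) (dv _ _ ga gb) (dv _ _ gb ga)).
exact: (normal_form_covector (real_theta_change ox) (real_eta_change ox) v1 zE
  ((hA _ cx).1 Au) ((hA _ dx).1 Av)).
Qed.

Lemma courant_closed_nf : courant_closed A.
Proof.
move=> a b ga gb; split; last by move=> c x cx; have [] := courant_section_local cx ga gb.
split=> [c i j|c i j|c d x ox]; last exact: courant_transforms.
- by split=> l x cx; have [h _ _ _] := courant_section_local cx ga gb;
    [exact: (h i j).1|exact: (h i j).2].
- by split=> l x cx; have [_ h _ _] := courant_section_local cx ga gb;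
    [exact: (h i j).1|exact: (h i j).2].
Qed.

(** Additivity and antisymmetry hold for all sections; the Jacobi identity and the Leibniz rule use
    the normal form. *)
Lemma lie_algebroid_nf : is_subbundle A -> lie_algebroid A.
Proof.
move=> subA; split; [exact: subA|exact: courant_closed_nf| | | |].
- move=> a b e ga gb ge c x cx; pose D := cod_domain cx; pose x0 : {x | dset D x} := exist _ x cx.
  have [[a1 a2 _] _] := ga; have [[b1 b2 _] _] := gb; have [[e1 e2 _] _] := ge.
  have [u ru] := @repg_ex _ _ D _ (a1 c) (a2 c); have [v rv] := @repg_ex _ _ D _ (b1 c) (b2 c).
  have [w rw] := @repg_ex _ _ D _ (e1 c) (e2 c).
  have ruv : repg (u + v) (fun y => a c y + b c y) by move=> y; rewrite map_gfibD ru rv.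
  rewrite -[LHS](repg_cou rw ruv x0) couD; last exact: sderD.
  apply: etrans (map_gfibD _ _ _) _.
  exact: (f_equal2 +%R (repg_cou rw ru x0) (repg_cou rw rv x0)).
- move=> a b ga gb c x cx; pose D := cod_domain cx; pose x0 : {x | dset D x} := exist _ x cx.
  have [[a1 a2 _] _] := ga; have [[b1 b2 _] _] := gb.
  have [u ru] := @repg_ex _ _ D _ (a1 c) (a2 c); have [v rv] := @repg_ex _ _ D _ (b1 c) (b2 c).
  rewrite -[LHS](repg_cou ru rv x0) cou_antisym; last exact: sderD.
  by rewrite map_gfibN (repg_cou rv ru).
- move=> a b e ga gb ge c x cx; pose D := cod_domain cx; pose x0 : {x | dset D x} := exist _ x cx.
  have sub : dset D `<=` chart_cod c by [].
  have [th [et [F [pi [rth ret rF rpi]]]]] := fields_rep sub.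
  have hAc y u : chart_cod c y -> A c y u <-> nf_bundle s p q c y u by exact: hA.
  have [u [ru nu]] := local_section_rep sub rth ret rF hAc (gsections_local sub ga).
  have [v [rv nv]] := local_section_rep sub rth ret rF hAc (gsections_local sub gb).
  have [w [rw nw]] := local_section_rep sub rth ret rF hAc (gsections_local sub ge).
  rewrite -[X in X + _ + _](repg_cou ru (repg_cou rv rw) x0).
  rewrite -[X in _ + X + _](repg_cou rv (repg_cou rw ru) x0).
  rewrite -[X in _ + _ + X](repg_cou rw (repg_cou ru rv) x0).
  by rewrite -!map_gfibD (nf_D_jacobi sub rth ret rF pq nu nv nw) map_gfib0.
- move=> a b f ga gb [sf _] c x cx; pose D := cod_domain cx; pose x0 : {x | dset D x} :=
  exist _ x cx.
  have sub : dset D `<=` chart_cod c by [].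
  have [th [et [F [pi [rth ret rF rpi]]]]] := fields_rep sub.
  have hAc y u : chart_cod c y -> A c y u <-> nf_bundle s p q c y u by exact: hA.
  have [u [ru nu]] := local_section_rep sub rth ret rF hAc (gsections_local sub ga).
  have [v [rv nv]] := local_section_rep sub rth ret rF hAc (gsections_local sub gb).
  have [g rg] := @repf_ex _ _ D _ (sf c).
  have rgv : repg (g *: v) (fun y => f c y *: b c y) by move=> y;
    rewrite map_gfibZ rv [X in X *: _]rg.
  rewrite -[LHS](repg_cou ru rgv x0) (nf_D_leibniz sub rth ret rF g pq nu nv).
  apply: etrans (map_gfibD _ _ _) _; apply: f_equal2; apply: etrans (map_gfibZ _ _ _) _.
  - exact: (f_equal2 *:%R (rg x0) (repg_cou ru rv x0)).
  - exact: (f_equal2 *:%R (repf_along (repg1 ru) rg x0) (rv x0)).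
Qed.

End BracketsOfSections.

(** * Local frames *)

Section Frames.
Variables (A : gbundle M) (s : R[i]) (p q : bool).
Hypothesis hA : forall c x u, chart_cod c x -> A c x u <-> nf_bundle s p q c x u.

Let sum_rows r (k : 'rV[R[i]]_r) (P Q : 'M[R[i]]_(r, m)) :
  \sum_i k 0 i *: ((row i P, row i Q) : gfib R[i] m) = (k *m P, k *m Q).
Proof.
rewrite [RHS](_ : _ = (\sum_i k 0 i *: row i P, \sum_i k 0 i *: row i Q)); last first.
  by rewrite !mulmx_sum_row.
by apply: (big_rec3 (fun a a' b => b = (a, a'))) => // i a a' b _ ->.
Qed.

Lemma is_subbundle_frame r :
  (forall c x, chart_cod c x -> exists U (P Q : 'rV[R]_m -> 'M[R[i]]_(r, m)),
    [/\ open U, U x, U `<=` chart_cod c, csmooth_mx_on U P /\ csmooth_mx_on U Q &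
     forall y, U y -> [/\ forall k : 'rV_r, nf_bundle s p q c y (k *m P y, k *m Q y),
       forall u, nf_bundle s p q c y u -> exists k : 'rV_r, u = (k *m P y, k *m Q y) &
       forall k : 'rV_r, k *m P y = 0 -> k *m Q y = 0 -> k = 0]]) ->
  is_subbundle A.
Proof.
move=> H; split=> [c d x u v ox t|].
  rewrite (hA _ (overlap_cod ox)) (hA _ (transition_cod ox)).
  exact: nfb_change.
exists r => c x cx; have [U [P [Q [oU Ux UC [sP sQ] PQ]]]] := H c x cx.
exists U, (fun k y => (row k (P y), row k (Q y))); split=> //.
- move=> k; split=> [i j|i j|y Uy] /=.
  + by apply: (csmooth_ext oU) (sP k j) => y _; rewrite mxE.
  + by apply: (csmooth_ext oU) (sQ k j) => y _; rewrite mxE.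
  + by apply/(hA _ (UC _ Uy)); have [nk _ _] := PQ y Uy; rewrite !rowE; exact: nk.
- move=> y u Uy; rewrite (hA _ (UC _ Uy)); have [nk ek ik] := PQ y Uy.
  split=> [/ek[k ->]|[k [-> _]]]; last by rewrite sum_rows; exact: nk.
  exists k; split=> [|k']; rewrite sum_rows// => -[e1 e2].
  by apply/subr0_eq; apply: ik; rewrite mulmxBl ?e1 ?e2 subrr.
Qed.

End Frames.

Lemma complex_fields c x (cx : chart_cod c x) :
  let th := real_mx (theta c x) in let et := real_mx (eta c x) in
  let F := real_mx (gF J c x) in let pi := real_mx (gpi J c x) in
  [/\ th^T = - th, pi^T = - pi, contract et F = 1, F *m th = 0 &
      et *m pi = 0 /\ th *m pi = et^T *m F - 1%:M].
Proof.
split; rewrite /real_mx.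
- by rewrite map_trmx theta_altx// map_mxN.
- by rewrite map_trmx pi_altx// map_mxN.
- by rewrite [LHS]real_contract etaFx// rmorph1.
- by rewrite -map_mxM Fthetax// map_mx0.
- by rewrite -!map_mxM eta_pix// theta_pix// map_mx0 map_mxB map_mxM map_trmx map_mx1.
Qed.

Let halfC : 2^-1 + 2^-1 = 1 :> R[i].
Proof. by rewrite -div1r -splitr. Qed.

Let ii2C : 'i%C * 'i%C = -1 :> R[i].
Proof. by rewrite -expr2 sqr_i. Qed.

Lemma is_subbundle_L A : (forall c x u, chart_cod c x ->
  A c x u <-> nf_bundle (- 'i%C) false true c x u) ->
  is_subbundle A.
Proof.
move=> hA; apply: (is_subbundle_frame hA (r := m)) => c x cx.
have sub : dset (cod_domain cx) `<=` chart_cod c by [].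
have [th [et [F [pi [rth ret rF rpi]]]]] := fields_rep sub.
exists (chart_cod c), (fun=> 1%:M), (fun y => - 'i%C *: real_mx (theta c y)); split=> //.
- exact: open_chart_cod.
- split.
    have r1 : repm (1%:M : 'M[sfun (cod_domain cx)]_m) (fun=> 1%:M) by move=> y; rewrite map_mx1.
    exact: (repm_smooth r1).
  have r2 : repm (sfun_cst (cod_domain cx) (- 'i%C) *: th) (fun y => - 'i%C *: real_mx (theta c y)).
    by move=> y; rewrite map_mxZ rth [X in X *: _]sfun_eval_cst.
  exact: (repm_smooth r2).
- move=> y cy; have [ta pa eF Ft [ep tp]] := complex_fields cy; split.
  + move=> k; rewrite mulmx1; split=> //= [|_].
      rewrite -scalemxAr contractZl (contract_thetaF ta Ft).
      by rewrite mulr0 scale0r addr0.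
    by rewrite -scalemxAr contractZl (contract_thetaF ta Ft) mulr0.
  + move=> u [u2 _ uF]; exists u.1; rewrite mulmx1 -scalemxAr.
    by rewrite [LHS]surjective_pairing {1}u2 uF// scale0r addr0.
  + by move=> k; rewrite mulmx1.
Qed.

Lemma is_subbundle_Lstar A : (forall c x u, chart_cod c x ->
  A c x u <-> nf_bundle 'i%C true false c x u) ->
  is_subbundle A.
Proof.
move=> hA; apply: (is_subbundle_frame hA (r := m)) => c x cx.
have sub : dset (cod_domain cx) `<=` chart_cod c by [].
have [th [et [F [pi [rth ret rF rpi]]]]] := fields_rep sub.
(* The frame consists of the images under [lift] of the coordinate covectors. *)
exists (chart_cod c), (fun y => 'i%C *: real_mx (gpi J c y)),
  (fun y => 1%:M + (real_mx (gF J c y))^T *m real_mx (eta c y)); split=> //.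
- exact: open_chart_cod.
- split.
    have r1 : repm (sfun_cst (cod_domain cx) 'i%C *: pi) (fun y => 'i%C *: real_mx (gpi J c y)).
      by move=> y; rewrite map_mxZ rpi [X in X *: _]sfun_eval_cst.
    exact: (repm_smooth r1).
  have r2 : repm (1%:M + F^T *m et) (fun y => 1%:M + (real_mx (gF J c y))^T *m real_mx (eta c y)).
    by move=> y; rewrite map_mxD map_mx1 map_mxM -map_trmx rF ret.
  exact: (repm_smooth r2).
- move=> y cy; have [ta pa eF Ft [ep tp]] := complex_fields cy.
  have fE k : (k *m ('i%C *: real_mx (gpi J c y)),
      k *m (1%:M + (real_mx (gF J c y))^T *m real_mx (eta c y))) =
      lift (real_mx (eta c y)) (real_mx (gF J c y)) (real_mx (gpi J c y)) 'i%C k.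
    by rewrite /lift -scalemxAr mulmxDr mulmx1 mulmxA contract_mx mul_scalar_mx.
  split.
  + by move=> k; rewrite fE; apply: (nfB_lift ta eF Ft pa ep tp ii2C) => //.
  + move=> v nv; exists (covector_of 2^-1 (real_mx (theta c y)) 'i%C v); rewrite fE.
    have [_ ev _] := nv.
    rewrite (nfB_graph nv); apply/esym/(lift_cov halfC ta eF Ft pa ep tp ii2C); exact: ev.
  + move=> k e1 e2.
    rewrite -(covK halfC ta pa tp ii2C k) -fE e1 e2.
    by rewrite /covector_of mul0mx scaler0 addr0 scaler0.
Qed.

(** The rank is one less than the dimension. As [eta(F) = 1], some component [F_j] is nonzero near
    [x]; the coordinate fields other than the [j]-th, projected to [ker eta], carry a frame
    there. *)
Lemma is_subbundle_E A s : (forall c x u, chart_cod c x ->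
  A c x u <-> nf_bundle s true true c x u) ->
  is_subbundle A.
Proof.
move=> hA; apply: (is_subbundle_frame hA (r := n.*2)) => c x cx.
have [j Fj] : exists j, gF J c x 0 j != 0.
  apply/existsP; apply: contraT => /existsPn F0.
  have F00 : gF J c x = 0 by apply/rowP => j; rewrite mxE; apply/eqP; move: (F0 j); rewrite negbK.
  by have := etaFx cx; rewrite F00 contract0r => /eqP; rewrite eq_sym oner_eq0.
pose U := [set y | chart_cod c y /\ gF J c y 0 j != 0].
have sF : smooth_on (chart_cod c) (fun y => gF J c y 0 j).
  by case: assocJ => [[h _] _ _]; exact: h.
have oU : open U.
  rewrite openE => y [cy Fy]; apply: filterI.
    by apply: open_nbhs_nbhs; split=> //; exact: open_chart_cod.
  have ct := differentiable_continuous (smooth_differentiable sF cy).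
  exact: (cvgr_neq0 _ ct Fy).
pose D := Domain oU (conj cx Fj).
have sub : dset D `<=` chart_cod c by move=> y [].
have [th [et [F [pi [rth ret rF rpi]]]]] := fields_rep sub.
(* [N] projects onto [ker eta] along [F]. Since [F *m theta = 0], the covectors of the frame need no
   projection. *)
pose N y : 'M[R[i]]_m := 1%:M - (real_mx (eta c y))^T *m real_mx (gF J c y).
exists U, (fun y => row' j (N y)), (fun y => s *: row' j (real_mx (theta c y))); split=> //.
- split.
    have r1 : repm (row' j (1%:M - et^T *m F)) (fun y => row' j (N y)).
      by move=> y; rewrite map_row' map_mxB map_mx1 map_mxM -map_trmx rF ret.
    exact: (repm_smooth r1).
  have r2 : repm (sfun_cst D s *: row' j th) (fun y => s *: row' j (real_mx (theta c y))).
    by move=> y; rewrite map_mxZ map_row' rth [X in X *: _]sfun_eval_cst.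
  exact: (repm_smooth r2).
- move=> y [cy Fy]; have [ta pa eF Ft [ep tp]] := complex_fields cy.
  set e := real_mx (eta c y) in eF ep tp *; set G := real_mx (gF J c y) in eF Ft tp *.
  set t := real_mx (theta c y) in ta Ft tp *.
  pose E := row' j (1%:M : 'M[R[i]]_m).
  have rowE' (B : 'M[R[i]]_m) : row' j B = E *m B.
    by apply/matrixP => a b; rewrite !mxE; under eq_bigr do rewrite !mxE;
       rewrite (bigD1 (fintype.lift j a))//= eqxx mul1r big1 ?addr0// => l /negPf;
       rewrite eq_sym => ->; rewrite mul0r.
  have Gj : G 0 j != 0.
    by rewrite mxE; apply: contra Fy => /eqP/(congr1 (@complex.Re R))/= ->.
  have NE (k : 'rV[R[i]]_m) : k *m N y = k - contract k e *: G.
    by rewrite mulmxBr mulmx1 mulmxA contract_mx mul_scalar_mx.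
  have Et : E *m E^T = 1%:M.
    apply/matrixP => a b; rewrite !mxE; under eq_bigr do rewrite !mxE.
    rewrite (bigD1 (fintype.lift j a))//= eqxx mul1r big1 ?addr0 => [|l /negPf].
      by rewrite (inj_eq lift_inj) eq_sym.
    by rewrite eq_sym => ->; rewrite mul0r.
  have Ej (k : 'rV[R[i]]_n.*2) : (k *m E) 0 j = 0.
    by rewrite mxE big1// => l _; rewrite !mxE eq_sym (negPf (neq_lift _ _)) mulr0.
  have EE (k : 'rV[R[i]]_m) : k 0 j = 0 -> k *m E^T *m E = k.
    move=> kj; apply/rowP => l; case: (unliftP j l) => [a ->|->]; last by rewrite Ej kj.
    rewrite mxE (bigD1 a)//= big1 ?addr0 => [|b /negPf ba]; last first.
      by rewrite !mxE (inj_eq lift_inj) ba mulr0.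
    rewrite !mxE eqxx mulr1 (bigD1 (fintype.lift j a))//= !mxE eqxx mulr1 big1 ?addr0// => b /negPf.
    by rewrite !mxE eq_sym => ->; rewrite mulr0.
  split.
  + move=> k; rewrite !rowE' -scalemxAr !mulmxA NE.
    set h := k *m E.
    split=> [|_|_] /=.
    * rewrite contractZl (contract_thetaF ta Ft) mulr0 scale0r addr0 mulmxBl -scalemxAl Ft.
      by rewrite scaler0 subr0.
    * by rewrite contractBr contractZr eF mulr1 contractC subrr.
    * by rewrite contractZl (contract_thetaF ta Ft) mulr0.
  (* A multiple of [F] is subtracted to make the [j]-th component vanish; the projection [N] then
     restores [u.1]. *)
  + move=> u [u2 u1 uF]; pose h := u.1 - (u.1 0 j / G 0 j) *: G.
    have hj : h 0 j = 0 by rewrite addmxE oppmxE scalemxE divfK ?subrr.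
    exists (h *m E^T); rewrite !rowE' -scalemxAr !mulmxA EE// NE.
    have he : contract h e = - (u.1 0 j / G 0 j).
      by rewrite contractBl contractZl contractC u1// contractC eF mulr1 sub0r.
    rewrite he scaleNr opprK subrK mulmxBl -scalemxAl Ft scaler0 subr0.
    by rewrite [LHS]surjective_pairing {1}u2 uF// scale0r addr0.
  + move=> k; rewrite rowE' mulmxA NE => /eqP; rewrite subr_eq0 => /eqP kE _.
    have := congr1 (fun v : 'rV_m => v 0 j) kE; rewrite Ej [RHS]mxE => /esym/eqP.
    rewrite mulf_eq0 (negPf Gj) orbF => /eqP c0.
    by rewrite -[k]mulmx1 -Et mulmxA kE c0 scale0r mul0mx.
Qed.

(** * Duality and compatibility of the two pairs *)

Section Duality.
Variables (A B : gbundle M) (b : bool).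
Hypothesis hA : forall c x u, chart_cod c x -> A c x u <-> nf_bundle (- 'i%C) b true c x u.
Hypothesis hB : forall c x u, chart_cod c x -> B c x u <-> nf_bundle 'i%C true b c x u.

Lemma in_duality_nf : in_duality A B.
Proof.
move=> c x cx; have [ta pa eF Ft [ep tp]] := complex_fields cx.
set e := real_mx (eta c x) in eF ep tp; set F := real_mx (gF J c x) in eF Ft tp.
set t := real_mx (theta c x) in ta Ft tp; set pi := real_mx (gpi J c x) in pa ep tp.
split=> [u /(hA _ cx) nu H|v /(hB _ cx) nv H].
- have uX : u = graph t e (- 'i%C) u.1 0 by exact: (nfA_graph nu).
  suff X0 : u.1 = 0 by rewrite uX X0 /graph mul0mx scaler0 scale0r addr0.
  have key a : (b -> contract a F = 0) -> contract a u.1 = 0.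
    move=> ba; have := H _ ((hB _ cx).2 (nfB_lift ta eF Ft pa ep tp ii2C ba)).
    by rewrite {1}uX [LHS](pair_graphN 2^-1 e ta) (covK halfC ta pa tp ii2C).
  apply/rowP => i; rewrite [RHS]mxE -contract_delta contractC.
  have [bT|bF] := boolP b; last by apply: key => h; rewrite h in bF.
  have e0 : contract e u.1 = 0 by case: nu => _ h _; exact: h.
  (* Subtracting a multiple of [eta] makes the test covector kill [F], and costs nothing because
     [u.1] lies in [ker eta]. *)
  have -> : contract (delta_mx 0 i) u.1
      = contract (delta_mx 0 i - contract (delta_mx 0 i) F *: e) u.1.
    by rewrite contractBl contractZl e0 mulr0 subr0.
  by apply: key => _; rewrite contractBl contractZl eF mulr1 subrr.
- have ev : contract e v.1 = 0 by case: nv => _ h _; exact: h.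
  have vg : v = graph t e 'i%C v.1 (contract v.2 F) by exact: (nfB_graph nv).
  have lv : lift e F pi 'i%C (covector_of 2^-1 t 'i%C v) = v.
    by rewrite [in LHS]vg (lift_cov halfC ta eF Ft pa ep tp ii2C).
  suff c0 : covector_of 2^-1 t 'i%C v = 0.
    by rewrite -lv c0 /lift mul0mx scaler0 contract0l scale0r addr0.
  have key X : (b -> contract e X = 0) -> contract (covector_of 2^-1 t 'i%C v) X = 0.
    move=> bX; rewrite -(pair_graphN 2^-1 e ta); apply: H; apply/(hA _ cx).
    split=> [|/bX //|_] /=; rewrite contractDl !contractZl (contract_thetaF ta Ft) mulr0 mul0r
      addr0 //.
  have [bT|bF] := boolP b; last first.
    by apply: contract_ext => X; rewrite contract0l; apply: key => h; rewrite h in bF.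
  have cF0 : contract (covector_of 2^-1 t 'i%C v) F = 0.
    have vF : contract v.2 F = 0 by case: nv => _ _ h; exact: h.
    by rewrite /covector_of contractZl contractDl contractZl vF (contract_thetaF ta Ft) mulr0
      addr0 mulr0.
  apply: contract_ext => X; rewrite contract0l.
  (* Dually, the test vector is moved along [F] into [ker eta]. *)
  have -> : contract (covector_of 2^-1 t 'i%C v) X
    = contract (covector_of 2^-1 t 'i%C v) (X - contract e X *: F).
    by rewrite contractBr contractZr cF0 mulr0 subr0.
  by apply: key => _; rewrite contractBr contractZr eF mulr1 subrr.
Qed.

Lemma bialgebroid_compatible_nf : bialgebroid_compatible A B.
Proof.
move=> a1 a2 ga1 ga2 c U oU UC r1 r2 P1 P2 [sP1 dP1] [sP2 dP2] xi zeta sx sz x Ux.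
pose D := Domain oU Ux; pose x0 : {y | dset D y} := exist _ x Ux.
have sub : dset D `<=` chart_cod c by [].
have [th [et [F [pi [rth ret rF rpi]]]]] := fields_rep sub.
have hAc y u : chart_cod c y -> A c y u <-> nf_bundle (- 'i%C) b true c y u by exact: hA.
have hBc y u : chart_cod c y -> B c y u <-> nf_bundle 'i%C true b c y u by exact: hB.
have repA e : local_section A c (dset D) e ->
    exists u, repg u e /\ normal_form th et F (- sfun_cst D 'i%C) b true u.
  move=> /(local_section_rep sub rth ret rF hAc)[u [ru nu]]; exists u; split; first exact: ru.
  rewrite (_ : - _ = sfun_cst D (- 'i%C)); first exact: nu.
  by apply: sfun_evalP => y; rewrite rmorphN/= !sfun_eval_cst.
have repB e : local_section B c (dset D) e ->
    exists u, repg u e /\ normal_form th et F (sfun_cst D 'i%C) true b u.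
  exact: (local_section_rep sub rth ret rF hBc).
have [u [ru nu]] := repA _ (gsections_local sub ga1).
have [v [rv nv]] := repA _ (gsections_local sub ga2).
have [xi' [rx nx]] := repB _ sx; have [zeta' [rz nz]] := repB _ sz.
have repP r (P : 'I_r -> ('rV[R]_m -> gfib R[i] m) * ('rV[R]_m -> gfib R[i] m)) :
    (forall k, local_section A c U (P k).1 /\ local_section A c U (P k).2) ->
    exists Q : 'I_r -> gfib (sfun D) m * gfib (sfun D) m, forall k,
      [/\ repg (Q k).1 (P k).1, repg (Q k).2 (P k).2,
          normal_form th et F (- sfun_cst D 'i%C) b true (Q k).1 &
          normal_form th et F (- sfun_cst D 'i%C) b true (Q k).2].
  move=> sP; suff /choice[Q hQ] : forall k, exists w : gfib (sfun D) m * gfib (sfun D) m,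
      [/\ repg w.1 (P k).1, repg w.2 (P k).2,
          normal_form th et F (- sfun_cst D 'i%C) b true w.1 &
          normal_form th et F (- sfun_cst D 'i%C) b true w.2] by exists Q.
  move=> k; have [s1 s2] := sP k.
  have [w1 [rw1 nw1]] := repA _ s1; have [w2 [rw2 nw2]] := repA _ s2.
  by exists (w1, w2).
have [Q1 hQ1] := repP _ _ sP1; have [Q2 hQ2] := repP _ _ sP2.
have ii2D : sfun_cst D 'i%C * sfun_cst D 'i%C = -1.
  by apply: sfun_evalP => y; rewrite rmorphM rmorphN rmorph1 /= sfun_eval_cst ii2C.
have ta := th_alt sub rth; have pa := pi_alt_rep sub rpi; have eF := et_F sub ret rF.
have Ft := F_th sub rth rF; have ep := et_pi sub ret rpi; have tp := th_pi sub rth ret rF rpi.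
have ec := et_closed sub ret; have tc := th_closed sub rth.
have decomp w e r (P : 'I_r -> _) Q : repg w e ->
  normal_form th et F (- sfun_cst D 'i%C) b true w ->
    (forall k, [/\ repg (Q k).1 (P k).1, repg (Q k).2 (P k).2,
          normal_form th et F (- sfun_cst D 'i%C) b true (Q k).1 &
          normal_form th et F (- sfun_cst D 'i%C) b true (Q k).2]) ->
    (forall V xi zeta, open V -> V `<=` U -> local_section B c V xi -> local_section B c V zeta ->
      forall y, V y -> d_star e xi zeta y = \sum_k wedge (P k).1 (P k).2 xi zeta y) ->
    \sum_k bivector (Q k).1.1 (Q k).2.1 = - sfun_cst D 'i%C *: lie_bivector (@sder _ _ D) w.1 pi.
  move=> rw nw hQ dP.
  apply: (decomposition_unique (@sderD _ _ D) (@sderM _ _ D) (shalfD D) ec ta tc eF Ft pa ep tp ii2D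
    (sder_const D _) (sder_const D _) nw) => [k|V W bV bW]; first by have [_ _ h1 h2] := hQ k.
  have sB a : (b -> contract a F = 0) -> exists2 e', repg (lift et F pi (sfun_cst D 'i%C) a) e' &
      local_section B c (dset D) e'.
    move=> ba; pose l := lift et F pi (sfun_cst D 'i%C) a.
    (* The components of the lift, read as functions, provide an actual local section over [U] on
       which the given decomposition can be tested. *)
    pose e' y : gfib R[i] m := (\row_j (l.1 0 j : sfun D) y, \row_j (l.2 0 j : sfun D) y).
    have re : repg l e' by move=> y; apply/pair_equal_spec; split; apply/rowP => j; rewrite !mxE.
    exists e' => //; apply: (rep_local_section sub rth ret rF hBc re).
    exact: (nfB_lift ta eF Ft pa ep tp ii2D ba).
  have [e1 re1 s1] := sB V bV; have [e2 re2 s2] := sB W bW.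
  apply: sfun_evalP => y; have Uy : U (sval y) by exact: svalP.
  rewrite rmorph_sum (repf_dst rw re1 re2 y) (dP U e1 e2 oU (fun _ h => h) s1 s2 _ Uy).
  apply: eq_bigr => k _; have [h1 h2 _ _] := hQ k.
  exact: esym (repf_wdg h1 h2 re1 re2 y).
have E1 := decomp _ _ _ _ _ ru nu hQ1 dP1; have E2 := decomp _ _ _ _ _ rv nv hQ2 dP2.
have id0 := bialgebroid_identity (@sderD _ _ D) (@sderM _ _ D) (@sderC _ _ D) (shalfD D) ec ta tc
  eF Ft
  pa ep tp ii2D (sder_const D _) (sder_const D _) nu nv nx nz
  (fun k => let: And4 _ _ h1 h2 := hQ1 k in conj h1 h2)
  (fun k => let: And4 _ _ h1 h2 := hQ2 k in conj h1 h2) E1 E2.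
apply: etrans (esym (repf_dst (repg_cou ru rv) rx rz x0)) _.
apply: etrans (congr1 (sfun_eval x0) id0) _; apply: etrans (rmorphD _ _ _) _.
apply: f_equal2; apply: etrans (rmorph_sum _ _ _ _) _; apply: eq_bigr => k _.
- have [h1 h2 _ _] := hQ1 k; apply: etrans (rmorphD _ _ _) _; apply: f_equal2.
  + exact: (repf_wdg (repg_cou h1 rv) h2 rx rz x0).
  + exact: (repf_wdg h1 (repg_cou h2 rv) rx rz x0).
- have [h1 h2 _ _] := hQ2 k; apply: etrans (rmorphD _ _ _) _; apply: f_equal2.
  + exact: (repf_wdg (repg_cou ru h1) h2 rx rz x0).
  + exact: (repf_wdg h1 (repg_cou ru h2) rx rz x0).
Qed.

End Duality.

End CosymplecticBundles.

Theorem proposition3p2 (R : realType) (n : nat) (M : manifold R n.*2.+1)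
    (eta : mfield M 'rV[R]_(n.*2.+1)) (theta : mfield M 'M[R]_(n.*2.+1))
    (cosymp : cosymplectic eta theta)
    (J : gac_structure M) (assocJ : associated eta theta J) :
  strong J /\
  lie_bialgebroid (bundle_L J) (bundle_Lstar J) /\
  lie_bialgebroid (E10 J) (E01 J).
Proof.
have hL := L_nf cosymp assocJ; have hLs := Lstar_nf cosymp assocJ.
have h10 := E10_nf cosymp assocJ; have h01 := E01_nf cosymp assocJ.
have aL := lie_algebroid_nf cosymp assocJ hL isT (is_subbundle_L cosymp assocJ hL).
have aLs := lie_algebroid_nf cosymp assocJ hLs isT (is_subbundle_Lstar cosymp assocJ hLs).
have a10 := lie_algebroid_nf cosymp assocJ h10 isT (is_subbundle_E cosymp assocJ h10).
have a01 := lie_algebroid_nf cosymp assocJ h01 isT (is_subbundle_E cosymp assocJ h01).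
split; first by split; [exact: la_closed aL|exact: la_closed aLs].
split; split=> //.
- exact: (in_duality_nf cosymp assocJ hL hLs).
- exact: (bialgebroid_compatible_nf cosymp assocJ hL hLs).
- exact: (in_duality_nf cosymp assocJ h10 h01).
- exact: (bialgebroid_compatible_nf cosymp assocJ h10 h01).
Qed.
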